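(* Let $T>0$, $\beta\in(0,1]$, and let $\eta:S\to(0,\infty)$ be measurable such that (i) there is a constant $c_T>0$ with $\frac1{c_T}\eta(y)\le E_{r,y}[\eta(Z_t)]\le c_T\eta(y)$ for $0\le r\le t\le T$ and $y\in S$, and (ii) $E_{t,y}[\eta(Z_T)]\to\eta(y)$ uniformly in $y$ as $t\uparrow T$. Let $X=(X_t,\mathcal G(I),\mathbb P_{r,\mu})$ be the superprocess on $[0,T]$ with parameters $Z$, $K(ds)=\frac1\beta\eta(Z_s)\,ds$ and $\psi(y,\xi)=(\xi/\eta(y))^{1+\beta}$, and let $J_A$ be the $J$-functional of $X$ associated with $A\in\mathcal A_T^1$. Let $h(r,y):=E_{r,y}[\eta(Z_T)]$. Then, for $k\ge0$, $0\le r<T$ and $z\in S$, $$-\log\mathbb E_{r,\delta_z}\bigl[e^{-J_A-k\langle\eta,X_T\rangle}\bigr]\le E_{r,z}\bigl[A[r,T]\bigr]+\frac{h(r,z)\,k}{\bigl(1+c_T^{-\beta}(T-r)k^\beta\bigr)^{1/\beta}}$$ and $$-\log\mathbb E_{r,\delta_z}\bigl[e^{-J_A}\mathbf 1_{\{X_T=0\}}\bigr]\le E_{r,z}\bigl[A[r,T]\bigr]+\frac{c_T\,h(r,z)}{(T-r)^{1/\beta}}.$$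
   Context: Markov process: $Z=(Z_t,\mathcal F(I),P_{r,z})$ is a time-inhomogeneous right (Markov) process with sample space $(\Omega,\mathcal F)$ and state space $(S,\mathcal B)$, where $S$ is a metrizable Luzin space with Borel field $\mathcal B$. The $\sigma$-algebra $\mathcal F(I)\subset\mathcal F$ contains the events observable during the time interval $I\subset[0,\infty)$. $P_{r,\mu}$ is the measure under which $Z$ starts at time $r\ge0$ with initial distribution $\mu$; $P_{r,z}=P_{r,\delta_z}$. ''Right process'' means that $t\mapsto Z_t(\omega)$ is càdlàg and that for $r<t$, measurable $f:S\to\mathbb R_+$ and probability measures $\mu$, the process $s\mapsto E_{s,Z_s}[f(Z_t)]$ is $P_{r,\mu}$-a.s. right-continuous on $[r,t)$. Additive functionals: a nonnegative additive functional $A$ of $Z$ is a random measure $A(dt)$ on $[0,\infty)$ such that $A(I)$ depends only on events in (the completion of) $\mathcal F(I)$ for every interval $I$. $\mathcal A_{(1)}$: those of the form $A[s,u]=\sum_{s\le t_i\le u}f_i(Z_{t_i})$ with finitely many times $t_1<\dots<t_n$ and bounded measurable $f_i\ge0$. $\mathcal A_{(2)}$: those $A$ for which there are $A_n\in\mathcal A_{(1)}$ with $A_n[r,\infty)\to A[r,\infty)$ $P_{r,z}$-a.s. for all $(r,z)$, with $A_n[T',\infty)=0$ for all $n$ for some $T'>0$, and $\sup_{\omega,n}A_n[0,T'](\omega)<\infty$. $\mathcal A$: all nonnegative additive functionals $A$ for which there are $A_n\in\mathcal A_{(2)}$ with $A_n(B)\nearrow A(B)$ for all measurable $B\subset\mathbb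 R_+$. $\mathcal A_T^1:=\{A\in\mathcal A: E_{r,z}[A[r,T]]<\infty$ and $A(T,\infty)=0$ $P_{r,z}$-a.s. for all $(r,z)\in[0,T]\times S\}$. Superprocess: $\langle f,\nu\rangle=\int f\,d\nu$. $\mathcal M^\eta$ is the class of nonnegative measures $\mu$ on $(S,\mathcal B)$ with $\int\eta\,d\mu<\infty$; $B_\eta^+$ is the class of bounded $\mathcal B$-measurable $f:S\to\mathbb R_+$ with $f\le c\eta$ for some constant $c$. The superprocess $X=((X_t)_{t\le T},\mathcal G(I),\mathbb P_{r,\mu})$ with the stated parameters is the $\mathcal M^\eta$-valued Markov process with $\mathbb E_{r,\mu}[e^{-\langle f,X_t\rangle}]=e^{-\langle u(r,\cdot),\mu\rangle}$ for $f\in B_\eta^+$, $\mu\in\mathcal M^\eta$, $r\le t\le T$, where $u$ is the unique solution in $B_\eta^+$ of $u(r,y)=E_{r,y}[f(Z_t)-\int_r^tu(s,Z_s)^{1+\beta}\frac1{\beta\eta(Z_s)^\beta}\,ds]$. Convention: $X_t=0$ $\mathbb P_{r,\mu}$-a.s. for $t<r$. $\{X_T=0\}$ is the event that $X_T$ is the zero measure. $J$-functionals: for $A\in\mathcal A_{(1)}\cap\mathcal A_T^1$ given by $A[s,u]=\sum_{s\le t_i\le u}f_i(Z_{t_i})$ with finitely many times $t_1<\dots<t_n$ and bounded measurable $f_i\ge0$, $J_A:=\sum_i\langle f_i,X_{t_i}\rangle$; for general $A\in\mathcal A_T^1$, $J_A$ is obtained by passing to the limit along approximating sequences as in the definitions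 of $\mathcal A_{(2)}$ and $\mathcal A$. $J_A$ is additive in $A$ (in particular $J_A+k\langle\eta,X_T\rangle$ is the $J$-functional of $A(dt)+k\eta(Z_T)\delta_T(dt)$) and $\mathbb E_{r,\mu}[e^{-J_A}]=e^{-\langle v(r,\cdot),\mu\rangle}$, where $v$ is the unique finite nonnegative solution of $v(r,y)=E_{r,y}[A[r,T]-\int_r^Tv(s,Z_s)^{1+\beta}\frac1{\beta\eta(Z_s)^\beta}\,ds]$. *)

(* Defs.v *)
From HB Require Import structures.
From mathcomp Require Import all_boot all_order all_algebra.
From mathcomp Require Import all_classical all_reals all_analysis.
From mathcomp Require Import measurable_realfun.

Set Implicit Arguments.
Unset Strict Implicit.
Unset Printing Implicit Defensive.

Import Order.TTheory GRing.Theory Num.Theory.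
Import numFieldNormedType.Exports.

Local Open Scope classical_set_scope.
Local Open Scope ring_scope.
Local Open Scope ereal_scope.

Definition borel (S : ptopologicalType) := g_sigma_algebraType (@open S).

(* Dellacherie-Meyer: a Borel subset of a compact metric space, up to
   homeomorphism. *)
Definition metrizable_luzin (R : realType) (S : ptopologicalType) : Prop :=
  exists (K : metricType R) (e : S -> K),
    [/\ compact [set: K], injective e,
        (forall U : set S, open U <-> exists2 V : set K, open V & U = e @^-1` V) &
        <<s @open K >> (range e)].

(* [D] is the time interval: [0, +oo[ for the spatial motion and [0, T] for the
   superprocess. [obs I] is the sigma-algebra of the events observable during
   the interval I, and [law r x] is P_{r,x}; P_{r,x} only matters on the events
   observable from time r on. *)
Record markov_process (R : realType) (D : set R) (d : measure_display)
    (E : measurableType d) (d' : measure_display) (Omega : measurableType d') :=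
  MarkovProcess {
  state :> R -> Omega -> E ;
  obs : set R -> set (set Omega) ;
  law : R -> E -> probability Omega R ;
  obs_sigma_algebra : forall I : set R, is_interval I -> I `<=` D ->
    sigma_algebra setT (obs I) ;
  obs_measurable : forall I : set R, is_interval I -> I `<=` D ->
    obs I `<=` measurable ;
  obs_subset : forall I I' : set R, is_interval I -> is_interval I' ->
    I `<=` I' -> I' `<=` D -> obs I `<=` obs I' ;
  state_obs : forall (I : set R) (t : R), is_interval I -> I `<=` D -> I t ->
    forall B : set E, measurable B -> obs I (state t @^-1` B) ;
  law_measurable : forall (r : R) (C : set Omega), D r ->
    obs (D `&` `[r, +oo[) C -> measurable_fun [set: E] (fun x => law r x C) ;
  law_initial : forall (r : R) (x : E) (B : set E), D r -> measurable B ->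
    law r x (state r @^-1` B) = \d_x B ;
  law_markov : forall (r t : R) (x : E) (C C' : set Omega),
    D r -> D t -> (r <= t)%R -> obs `[r, t] C -> obs (D `&` `[t, +oo[) C' ->
    law r x (C `&` C') = \int[law r x]_(w in C) law t (state t w) C' }.

Notation Rplus R := (`[0%R, +oo[%classic : set R).

(* [Q] is P_{r,mu}, the law of the process started at time r with initial
   distribution mu. *)
Definition initial_law (R : realType) (D : set R) (d : measure_display)
    (E : measurableType d) (d' : measure_display) (Omega : measurableType d')
    (Z : markov_process D E Omega) (r : R) (mu : probability E R)
    (Q : probability Omega R) : Prop :=
  forall C : set Omega, obs Z (D `&` `[r, +oo[) C ->
    Q C = \int[mu]_z law Z r z C.

Definition cadlag (R : realType) (S : topologicalType) (g : R -> S) : Prop :=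
  (forall t : R, (0 <= t)%R -> g s @[s --> t^'+] --> g t) /\
  (forall t : R, (0 < t)%R -> exists l : S, g s @[s --> t^'-] --> l).

Definition right_process (R : realType) (S : ptopologicalType)
    (d' : measure_display) (Omega : measurableType d')
    (Z : markov_process (Rplus R) (borel S) Omega) : Prop :=
  (forall w : Omega, cadlag (fun t => Z t w : S)) /\
  (forall (r t : R) (f : borel S -> R) (mu : probability (borel S) R)
      (Q : probability Omega R),
    (0 <= r < t)%R -> measurable_fun [set: borel S] f ->
    (forall y, 0 <= f y)%R -> initial_law Z r mu Q ->
    {ae Q, forall w, forall s : R, (r <= s < t)%R ->
      let m q := \int[law Z q (Z q w)]_w' (f (Z t w'))%:E in
      m q @[q --> s^'+] --> m s}).

Section additive_functionals.
Context (R : realType) (S : ptopologicalType) (d' : measure_display)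
  (Omega : measurableType d') (Z : markov_process (Rplus R) (borel S) Omega).

(* A random measure on the half-line is a kernel from Omega to the line that
   does not charge the negative numbers. *)
Notation random_measure := (R.-ker Omega ~> measurableTypeR R).

(* Completion of [obs Z I] with respect to all the laws P_{r,mu} for which
   I lies after time r. *)
Definition obs_completion (I : set R) : set (set Omega) :=
  [set C | forall (r : R) (mu : probability (borel S) R)
      (Q : probability Omega R),
    (0 <= r)%R -> I `<=` `[r, +oo[ -> initial_law Z r mu Q ->
    exists C0 N : set Omega, [/\ obs Z I C0, obs Z I N, Q N = 0 &
      (C `\` C0) `|` (C0 `\` C) `<=` N]].

Definition additive_functional (A : random_measure) : Prop :=
  (forall w, A w `]-oo, 0%R[%classic = 0) /\
  (forall I : set R, is_interval I -> I `<=` Rplus R ->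
    forall B : set (\bar R), measurable B ->
      obs_completion I ((fun w => A w I) @^-1` B)).

Definition atomic_functional (n : nat) (t : 'I_n -> R) (f : 'I_n -> borel S -> R)
    (A : random_measure) : Prop :=
  [/\ (forall i, 0 <= t i)%R,
      (forall i j : 'I_n, (i < j)%N -> (t i < t j)%R),
      (forall i, measurable_fun [set: borel S] (f i)),
      (forall i, exists M : R, forall y, 0 <= f i y <= M)%R &
      forall (w : Omega) (s u : R), (0 <= s <= u)%R ->
        A w `[s, u]%classic = (\sum_(i < n | (s <= t i <= u)%R) f i (Z (t i) w))%R%:E].

Definition calA1 (A : random_measure) : Prop :=
  additive_functional A /\
  exists (n : nat) (t : 'I_n -> R) (f : 'I_n -> borel S -> R),
    atomic_functional t f A.

(* The sequence approximates [A] as in the definition of [calA2]; the almost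
   sure convergence is required for the starting times in [D]. *)
Definition bounded_approx (D : set R) (An : nat -> random_measure)
    (A : random_measure) : Prop :=
  (forall (r : R) (z : borel S), D r ->
    {ae law Z r z, forall w,
      An n w `[r, +oo[%classic @[n --> \oo] --> A w `[r, +oo[%classic}) /\
  (exists T' : R, [/\ (0 < T')%R,
    (forall n w, An n w `[T', +oo[%classic = 0) &
    exists M : R, forall n w, An n w `[0%R, T']%classic <= M%:E]).

Definition calA2 (A : random_measure) : Prop :=
  additive_functional A /\
  exists An : nat -> random_measure,
    (forall n, calA1 (An n)) /\ bounded_approx (Rplus R) An A.

Definition monotone_approx (An : nat -> random_measure)
    (A : random_measure) : Prop :=
  forall (w : Omega) (B : set R), measurable B -> B `<=` Rplus R ->
    {homo (fun n => An n w B) : m n / (m <= n)%N >-> m <= n} /\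
    An n w B @[n --> \oo] --> A w B.

Definition calA (A : random_measure) : Prop :=
  additive_functional A /\
  exists An : nat -> random_measure,
    (forall n, calA2 (An n)) /\ monotone_approx An A.

Definition calA1T (T : R) (A : random_measure) : Prop :=
  calA A /\
  forall (r : R) (z : borel S), (0 <= r <= T)%R ->
    \int[law Z r z]_w A w `[r, T]%classic < +oo /\
    {ae law Z r z, forall w, A w `]T, +oo[%classic = 0}.

End additive_functionals.

Section eta_measures.
Context (R : realType) (S : ptopologicalType) (eta : {mfun borel S >-> R}).

Record eta_measure := EtaMeasure {
  eta_measure_val :> {measure set (borel S) -> \bar R} ;
  eta_measure_fin : \int[eta_measure_val]_y (eta y)%:E < +oo }.

Lemma mzero_eta_fin : \int[@mzero _ (borel S) R]_y (eta y)%:E < +oo.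
Proof. by rewrite integral_measure_zero. Qed.

HB.instance Definition _ := gen_eqMixin eta_measure.
HB.instance Definition _ := gen_choiceMixin eta_measure.
HB.instance Definition _ := isPointed.Build eta_measure (EtaMeasure mzero_eta_fin).

Definition evaluation_sets : set (set eta_measure) :=
  [set C | exists (B : set (borel S)) (U : set (\bar R)),
    [/\ measurable B, measurable U & C = [set mu : eta_measure | U (mu B)]]].

Definition eta_measures := g_sigma_algebraType evaluation_sets.

Lemma dirac_eta_fin (z : borel S) : \int[\d_z]_y (eta y)%:E < +oo.
Proof.
rewrite integral_dirac// ?diracT ?mul1e ?ltry//.
exact/measurable_EFinP.
Qed.

Definition eta_dirac (z : borel S) : eta_measures := EtaMeasure (dirac_eta_fin z).

Definition Bplus (f : borel S -> R) : Prop :=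
  [/\ measurable_fun [set: borel S] f, (forall y, 0 <= f y)%R,
      (exists M : R, forall y, f y <= M)%R &
      (exists c : R, forall y, f y <= c * eta y)%R].

End eta_measures.

Section superprocess.
Context (R : realType) (S : ptopologicalType)
  (dO : measure_display) (Omega : measurableType dO)
  (dX : measure_display) (OmegaX : measurableType dX)
  (T beta : R) (eta : {mfun borel S >-> R})
  (Z : markov_process (Rplus R) (borel S) Omega)
  (X : markov_process `[0%R, T] (eta_measures eta) OmegaX).

Definition pairing (f : borel S -> R) (nu : eta_measures eta) : \bar R :=
  \int[nu]_y (f y)%:E.

(* The integrand is psi(Z_s, u(s, Z_s)) K(ds), with
   psi(y, xi) = (xi / eta(y))^(1+beta) and K(ds) = eta(Z_s) / beta ds. *)
Definition evolution_solution (f : borel S -> R) (t : R)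
    (u : R -> borel S -> R) : Prop :=
  [/\ measurable_fun (`[0%R, t] `*` [set: borel S])
        (fun p : measurableTypeR R * borel S => u p.1 p.2),
      (forall r : R, (0 <= r <= t)%R -> Bplus eta (u r)) &
      forall (r : R) (y : borel S), (0 <= r <= t)%R ->
        (u r y)%:E = \int[law Z r y]_w ((f (Z t w))%:E -
          \int[@lebesgue_measure R]_(s in `[r, t])
            (u s (Z s w) `^ (1 + beta) / (beta * eta (Z s w) `^ beta))%R%:E)].

Definition is_superprocess : Prop :=
  (forall (f : borel S -> R) (t : R), Bplus eta f -> (0 <= t <= T)%R ->
    exists u : R -> borel S -> R,
      [/\ evolution_solution f t u,
          (forall u', evolution_solution f t u' ->
            forall r y, (0 <= r <= t)%R -> u' r y = u r y) &
          forall (r : R) (mu : eta_measures eta), (0 <= r <= t)%R ->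
            \int[law X r mu]_w expeR (- pairing f (X t w)) =
            expeR (- pairing (u r) mu)]) /\
  (forall (r t : R) (mu : eta_measures eta), (0 <= t)%R -> (t < r)%R ->
    (r <= T)%R -> {ae law X r mu, forall w, X t w setT = 0}).

Notation random_measure := (R.-ker Omega ~> measurableTypeR R).

(* The atoms after time T, if any, vanish almost surely since
   [A] belongs to [calA1T]; X is not defined there. *)
Definition J_atomic (A : random_measure) (J : OmegaX -> \bar R) : Prop :=
  calA1T Z T A /\
  exists (n : nat) (t : 'I_n -> R) (f : 'I_n -> borel S -> R),
    atomic_functional Z t f A /\
    J = (fun w => \sum_(i < n | (t i <= T)%R) pairing (f i) (X (t i) w)).

(* J-functionals are defined up to null sets: [J] is a version of J_A under
   P_{r,mu}, obtained along one approximating sequence. Passing to a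
   subsequence, a limit in probability gives a limit almost surely. *)
Definition J_bounded (r : R) (mu : eta_measures eta) (A : random_measure)
    (J : OmegaX -> \bar R) : Prop :=
  [/\ calA2 Z A, calA1T Z T A &
    exists (An : nat -> random_measure) (Jn : nat -> OmegaX -> \bar R),
      [/\ (forall n, calA1 Z (An n) /\ J_atomic (An n) (Jn n)),
          bounded_approx Z `[0%R, T] An A &
          {ae law X r mu, forall w, Jn n w @[n --> \oo] --> J w}]].

Definition J_functional (r : R) (mu : eta_measures eta) (A : random_measure)
    (J : OmegaX -> \bar R) : Prop :=
  [/\ measurable_fun [set: OmegaX] J, calA1T Z T A &
    exists (An : nat -> random_measure) (Jn : nat -> OmegaX -> \bar R),
      [/\ (forall n, J_bounded r mu (An n) (Jn n)),
          monotone_approx An A &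
          {ae law X r mu, forall w, Jn n w @[n --> \oo] --> J w}]].

End superprocess.

(* Main.v *)
Require Import Defs.
From HB Require Import structures.
From mathcomp Require Import all_boot all_order all_algebra.
From mathcomp Require Import all_classical all_reals all_analysis.
From mathcomp Require Import measurable_realfun.
From mathcomp Require Import ring lra.

(** Let u be the log-Laplace function of <F, X_T>, where F <= k eta. Both
    bounds follow from

      - log E_{r,delta_z}[exp (- J_A - <F, X_T>)] <= E_{r,z}[A[r,T]] + u(r, z),
      u(r, z) <= h(r,z) k / (1 + cT^(-beta) (T - r) k^beta)^(1/beta).

    First inequality. When A is carried by finitely many times, the Markov
    property of X removes its atoms one at a time, starting with the earliest.
    At an atom with coefficient f at time t, one has to see that the
    log-Laplace function of f + g exceeds the one of g by at most
    E[f(Z_t)]. Since f >= 0, the Laplace formula shows that the former is the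
    larger of the two at every point; so is then its branching term, which the
    evolution equation subtracts ([log_laplace_subadditive],
    [atom_laplace_ge]). The Laplace formula thus plays the part of a comparison
    principle for the evolution equation.

    Second inequality. Put U(s) = E_{r,z}[u(s, Z_s)]. The increments of U are
    the integrals of E_{r,z}[u(s,Z_s)^(1+beta) / (beta eta(Z_s)^beta)], and
    E_{r,z}[eta(Z_s)] <= H := cT h(r,z). Young's inequality with the slope
    U(a) / H yields U(b) - U(a) >= (b - a) U(a)^(1+beta) / (beta H^beta) for
    a <= b ([mean_rate_ge]). An Euler scheme over finer and finer partitions
    turns this into U(r)^(-beta) >= U(T)^(-beta) + (T - r) / H^beta
    ([powRN_euler]), which is the claim because U(r) = u(r,z) and
    U(T) <= k h(r,z) ([evolution_decay]).

    The coefficients of A and k eta need not lie in B_eta^+. They are truncated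
    to f /\ N eta and k eta /\ N; dominated convergence removes the truncation
    and then carries the bound to the limits that define J_A
    ([atomic_lower_bound], [bounded_lower_bound], [J_functional_lower_bound]).
    The event X_T = 0 is <eta, X_T> = 0, so its indicator is the limit of
    exp (- k <eta, X_T>) as k grows, while the bound stays below
    E_{r,z}[A[r,T]] + cT h(r,z) / (T - r)^(1/beta) ([powR_saturation]).

    Two measure-theoretic facts support the argument: the Markov property for
    functionals rather than events ([law_markov_fun]) and the joint
    measurability of (s, w) |-> Z_s(w), which makes the branching term a
    functional of the future of s and allows Tonelli's theorem
    ([right_continuous_measurable], [branching_loss_tonelli]). *)

Set Implicit Arguments.
Unset Strict Implicit.
Unset Printing Implicit Defensive.

Import Order.TTheory GRing.Theory Num.Theory.
Import numFieldNormedType.Exports.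

Local Open Scope classical_set_scope.
Local Open Scope ring_scope.
Local Open Scope ereal_scope.

(** * Power inequalities *)

Section real_inequalities.
Local Open Scope ring_scope.
Context {R : realType}.
Implicit Types x y t b : R.

(** The convex function x^(1+b) / y^b is homogeneous of degree one, hence lies
    above its tangent plane along x = t y. A constant t makes the
    lower bound linear in x and y, so that it passes to expectations. *)
Lemma young_tangent b x y t : 0 < b -> 0 <= x -> 0 < y -> 0 <= t ->
  (1 + b) / b * t `^ b * x <=
  x `^ (1 + b) / (b * y `^ b) + t `^ (1 + b) * y.
Proof.
move=> b0 x0 y0 t0.
have b1 : 0 < 1 + b by rewrite addr_gt0.
have q0 : 0 < (1 + b) / b by rewrite divr_gt0.
have tb : (t `^ b) `^ ((1 + b) / b) = t `^ (1 + b).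
  by rewrite -powRrM mulrCA divff ?mulr1// gt_eqF.
have xy0 : 0 <= x / y by rewrite divr_ge0// ltW.
have pq : (1 + b)^-1 + ((1 + b) / b)^-1 = 1 :> R.
  rewrite invfM invrK; field; lra.
have := conjugate_powR xy0 (powR_ge0 t b) b1 q0 pq.
rewrite tb => H.
have -> : x `^ (1 + b) / (b * y `^ b) = (1 + b) / b * y * ((x / y) `^ (1 + b) / (1 + b)).
  rewrite powRM ?invr_ge0 ?(ltW y0) // -(powR_inv1 (ltW y0)) -powRrM mulN1r powRN.
  have -> : y `^ (1 + b) = y * y `^ b.
    by rewrite powRD ?powRr1 ?(ltW y0)// gt_eqF ?implybT.
  have yb : y `^ b != 0 by rewrite gt_eqF// powR_gt0.
  by field; rewrite yb !gt_eqF.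
have -> : t `^ (1 + b) * y = (1 + b) / b * y * (t `^ (1 + b) / ((1 + b) / b)).
  by field; rewrite !gt_eqF.
rewrite -mulrDr; apply: le_trans (ler_wpM2l _ H); last by rewrite mulr_ge0// ltW.
by rewrite le_eqVlt; apply/orP; left; apply/eqP; field; rewrite !gt_eqF.
Qed.

(** Convexity of x |-> x^(-b), read off from e^v >= 1 + v and ln v <= v - 1. *)
Lemma powRN_tangent b x y : 0 < b -> 0 < x -> 0 < y ->
  y `^ (- b) + b * y `^ (- b) * ((y - x) / y) <= x `^ (- b).
Proof.
move=> b0 x0 y0.
have s0 : 0 < x / y by rewrite divr_gt0.
have -> : x `^ (- b) = y `^ (- b) * (x / y) `^ (- b).
  rewrite -powRM ?(ltW y0) ?(ltW s0)// mulrCA divff ?mulr1// gt_eqF//.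
rewrite -mulrA mulrCA -[X in X + _]mulr1 -mulrDr ler_wpM2l// ?powR_ge0//.
rewrite /powR gt_eqF//.
apply: le_trans (expR_ge1Dx _); rewrite lerD2l mulNr -mulrN ler_wpM2l ?(ltW b0)//.
have := @le_ln1Dx R (x / y - 1); rewrite addrCA subrr addr0 => H.
rewrite lerNr; apply: le_trans (H _) _; first lra.
rewrite le_eqVlt; apply/orP; left; apply/eqP; field; by rewrite gt_eqF.
Qed.

(** One Euler step for U' = kap U^(1+b), along whose solutions U^(-b) + b kap s
    is constant. The tangent is taken at y' = x + d kap x^(1+b) and not at y:
    the ratio y' / x is close to 1 even if y is far above x. *)
Lemma powRN_step (b kap d x y M : R) : 0 < b -> 0 < kap -> 0 <= d -> 0 < x -> x <= M ->
  x + d * kap * x `^ (1 + b) <= y ->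
  y `^ (- b) + b * kap * d * (1 - (1 + b) * (d * kap * M `^ b)) <= x `^ (- b).
Proof.
move=> b0 k0 d0 x0 xM; set y' := x + _ => y'y.
have xb : x `^ (1 + b) = x * x `^ b.
  rewrite powRD; first by rewrite powRr1// ltW.
  by rewrite (gt_eqF x0) implybT.
have dk0 : 0 <= d * kap by rewrite mulr_ge0// ltW.
have y'0 : 0 < y' by rewrite ltr_wpDr// mulr_ge0// powR_ge0.
set eps := d * kap * M `^ b.
have eps0 : 0 <= eps by rewrite mulr_ge0// powR_ge0.
have y'x : y' <= x * (1 + eps).
  rewrite /y' xb mulrDr mulr1 lerD2l /eps mulrCA.
  apply: ler_wpM2l; first exact: ltW.
  apply: ler_wpM2l => //.
  apply: ge0_ler_powR; rewrite ?nnegrE ?(ltW b0) ?(ltW x0)//.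
  exact: le_trans (ltW x0) xM.
have yy' : y `^ (- b) <= y' `^ (- b).
  rewrite !powRN lef_pV2 ?posrE ?powR_gt0 ?(lt_le_trans y'0)//.
  by rewrite ge0_ler_powR ?nnegrE ?(ltW b0) ?(ltW y'0)// (le_trans (ltW y'0)).
apply: le_trans (powRN_tangent b0 x0 y'0).
apply: lerD => //.
have -> : b * y' `^ (- b) * ((y' - x) / y') =
    b * kap * d * (x / y') `^ (1 + b).
  have -> : y' - x = d * kap * x `^ (1 + b) by rewrite /y' addrC addKr.
  rewrite powRM ?invr_ge0 ?(ltW x0) ?(ltW y'0)//.
  rewrite -(powR_inv1 (ltW y'0)) -powRrM mulN1r opprD.
  rewrite (@powRD _ y' (-1) (- b)) ?(gt_eqF y'0) ?implybT//.
  ring.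
rewrite ler_wpM2l//; first by rewrite !mulr_ge0// ltW.
have eps1 : 0 < 1 + eps by rewrite ltr_wpDr.
have b1 : 0 < 1 + b by rewrite addr_gt0.
have H : (1 + eps)^-1 <= x / y'.
  by rewrite ler_pdivlMr// mulrC ler_pdivrMr.
apply: (@le_trans _ _ ((1 + eps)^-1 `^ (1 + b))); last first.
  rewrite ge0_ler_powR ?nnegrE ?(ltW b1)// ?invr_ge0 ?(ltW eps1)//.
  by rewrite divr_ge0// ltW.
rewrite -(powR_inv1 (ltW eps1)) -powRrM mulN1r.
apply: le_trans (powRN_tangent b1 eps1 ltr01).
rewrite powR1 divr1; lra.
Qed.

(** Sum of N Euler steps of equal length, as N grows. The bound U <= U T makes
    the error terms of [powRN_step] uniformly of order 1 / N. *)
Lemma powRN_euler (b kap r T : R) (U : R -> R) : 0 < b -> 0 < kap -> r < T -> 0 < U r ->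
  (forall a c, r <= a -> a <= c -> c <= T ->
    U a + (c - a) * kap * U a `^ (1 + b) <= U c) ->
  U T `^ (- b) + b * kap * (T - r) <= U r `^ (- b).
Proof.
move=> b0 k0 rT Ur0 HU.
have Und a c : r <= a -> a <= c -> c <= T -> U a <= U c.
  move=> ra ac cT; apply: le_trans (HU _ _ ra ac cT).
  by rewrite lerDl !mulr_ge0 ?powR_ge0// ?(ltW k0)// subr_ge0.
pose C := (1 + b) * kap * U T `^ b * (T - r).
have Tr0 : 0 < T - r by rewrite subr_gt0.
have key N : U T `^ (- b) + b * kap * (T - r) * (1 - C / N.+1%:R) <= U r `^ (- b).
  pose d := (T - r) / N.+1%:R.
  have N0 : 0 < N.+1%:R :> R by rewrite ltr0n.
  have d0 : 0 < d by rewrite divr_gt0.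
  have rNd : r + N.+1%:R * d = T by rewrite /d mulrCA divff ?gt_eqF// mulr1; lra.
  have aux n : (n <= N.+1)%N ->
      U (r + n%:R * d) `^ (- b) + b * kap * (n%:R * d) * (1 - C / N.+1%:R)
      <= U r `^ (- b).
    elim: n => [_|n IH nN]; first by rewrite !mul0r mulr0 !mul0r !addr0.
    apply: le_trans (IH (ltnW nN)).
    have nT m : (m <= N.+1)%N -> r + m%:R * d <= T.
      by move=> mN; rewrite -rNd lerD2l ler_wpM2r ?ler_nat// ltW.
    have rn m : r <= r + m%:R * d by rewrite lerDl mulr_ge0// ltW.
    have nS : r + n%:R * d <= r + n.+1%:R * d.
      by rewrite lerD2l ler_wpM2r ?ler_nat// ltW.
    have Un0 : 0 < U (r + n%:R * d).
      by apply: lt_le_trans Ur0 (Und _ _ _ _ _) => //; apply: nT; exact: ltnW.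
    have UnT : U (r + n%:R * d) <= U T.
      by apply: Und => //; apply: nT; exact: ltnW.
    have := HU _ _ (rn n) nS (nT _ nN).
    have -> : r + n.+1%:R * d - (r + n%:R * d) = d by rewrite -natr1; ring.
    move=> /(powRN_step b0 k0 (ltW d0) Un0 UnT).
    have -> : (1 + b) * (d * kap * U T `^ b) = C / N.+1%:R.
      by rewrite /C /d; ring.
    have arith (u u' m e c K : R) : u' + c * e * K <= u ->
      u' + c * ((m + 1) * e) * K <= u + c * (m * e) * K by lra.
    by move=> H; have := arith _ _ n%:R _ _ _ H; rewrite natr1.
  have := aux N.+1 (leqnn _); rewrite rNd.
  by have -> : N.+1%:R * d = T - r by rewrite -[X in X - r]rNd addrAC subrr add0r.
apply/ler_addgt0Pr => e e0.
pose K := b * kap * (T - r) * C.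
have K0 : 0 <= K.
  by rewrite /K /C !mulr_ge0 ?powR_ge0 ?(ltW Tr0) ?(ltW k0) ?(ltW b0)// addr_ge0// ltW.
have := key (Num.truncn (K / e)).
set N := (Num.truncn _).+1%:R : R => H.
have N0 : 0 < N by rewrite ltr0n.
have KN : K / N <= e.
  by rewrite ler_pdivrMr// mulrC -ler_pdivrMr// ltW// truncnS_gt.
have E : b * kap * (T - r) * (1 - C / N) = b * kap * (T - r) - K / N.
  by rewrite /K; ring.
move: H; rewrite E addrA lerBlDr => H; apply: le_trans H _.
by rewrite lerD2l.
Qed.

Lemma powRK b x : b != 0 -> 0 <= x -> (x `^ b) `^ b^-1 = x.
Proof. by move=> b0 x0; rewrite -powRrM divff// powRr1. Qed.

(** As uT <= h k, the left-hand side of the last hypothesis is at least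
    (h k)^(-b) D, where D is the denominator 1 + c^(-b) tau k^b. *)
Lemma powRN_inv_bound (b c tau k h u uT : R) : 0 < b -> 0 < c -> 0 <= tau ->
  0 < k -> 0 < h -> 0 < u -> 0 < uT -> uT <= h * k ->
  uT `^ (- b) + b * (b * (c * h) `^ b)^-1 * tau <= u `^ (- b) ->
  u <= h * (k / (1 + c `^ (- b) * tau * k `^ b) `^ b^-1).
Proof.
move=> b0 c0 tau0 k0 h0 u0 uT0 uTk uuT.
set D := 1 + _.
have D0 : 0 < D by rewrite /D ltr_wpDr// !mulr_ge0// powR_ge0.
have hk0 : 0 < h * k by rewrite mulr_gt0.
have hkb0 : 0 < (h * k) `^ b by rewrite powR_gt0.
have bn0 : b != 0 by rewrite gt_eqF.
have E : ((h * k) `^ b)^-1 * D <= u `^ (- b).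
  apply: le_trans uuT.
  have -> : ((h * k) `^ b)^-1 * D =
      ((h * k) `^ b)^-1 + b * (b * (c * h) `^ b)^-1 * tau.
    rewrite /D powRN !powRM ?(ltW h0) ?(ltW c0) ?(ltW k0)//.
    by field; rewrite bn0 !gt_eqF// powR_gt0.
  rewrite lerD2r powRN lef_pV2 ?posrE ?powR_gt0//.
  by rewrite ge0_ler_powR ?nnegrE ?(ltW b0) ?(ltW uT0) ?(ltW hk0).
have ub0 : 0 < u `^ b by rewrite powR_gt0.
have {}E : u `^ b <= (h * k) `^ b / D.
  move: E; rewrite powRN mulrC ler_pdivrMr// ler_pdivlMl// => E.
  by rewrite ler_pdivlMr// mulrC [_ * D]mulrC.
have bV0 : 0 <= b^-1 by rewrite invr_ge0 ltW.
rewrite -[leLHS](@powRK b u) ?(ltW u0)// mulrA.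
apply: (@le_trans _ _ (((h * k) `^ b / D) `^ b^-1)).
  apply: ge0_ler_powR => //; rewrite nnegrE; first exact: ltW.
  by rewrite divr_ge0// ltW.
rewrite powRM ?invr_ge0 ?(ltW D0) ?(ltW hkb0)// powRK ?(ltW hk0)//.
by rewrite -(powR_inv1 (ltW D0)) -powRrM mulN1r powRN.
Qed.

(** The left-hand side is (k^(-b) + c^(-b) tau)^(-1/b), which increases to the
    right-hand side as k grows. *)
Lemma powR_saturation (b c tau k : R) : 0 < b -> 0 < c -> 0 < tau -> 0 <= k ->
  k / (1 + c `^ (- b) * tau * k `^ b) `^ b^-1 <= c / tau `^ b^-1.
Proof.
move=> b0 c0 tau0 k0.
have bV0 : 0 < b^-1 by rewrite invr_gt0.
have tb0 : 0 < tau `^ b^-1 by rewrite powR_gt0.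
set D := 1 + _.
have D0 : 0 < D by rewrite /D ltr_wpDr// !mulr_ge0// ?powR_ge0 ?ltW.
rewrite ler_pdivrMr ?powR_gt0// mulrAC ler_pdivlMr// -ler_pdivrMl//.
rewrite -(powR_inv1 (ltW c0)).
have -> : c `^ (-1) * (k * tau `^ b^-1) = (c `^ (- b) * tau * k `^ b) `^ b^-1.
  rewrite !powRM ?mulr_ge0 ?powR_ge0 ?(ltW tau0)// -!powRrM mulNr divff ?gt_eqF//.
  by rewrite powRr1//; ring.
by rewrite ge0_ler_powR ?nnegrE ?(ltW bV0) ?(ltW D0) ?lerDr// !mulr_ge0 ?powR_ge0 ?(ltW tau0).
Qed.

End real_inequalities.

(** * The Markov property for functionals *)

Section monotone_class.
Import HBNNSimple.

(** Nonnegative measurable functions are nondecreasing limits of finite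
    combinations of indicators. This is how identities between measures of
    events become identities between integrals. *)
Lemma ge0_measurable_fun_ind d (T : measurableType d) (R : realType)
    (P : (T -> \bar R) -> Prop) :
  (forall B, measurable B -> P (fun x => (\1_B x)%:E)) ->
  (forall f g : T -> \bar R, measurable_fun setT f -> measurable_fun setT g ->
    (forall x, 0 <= f x) -> (forall x, 0 <= g x) -> P f -> P g ->
    P (fun x => f x + g x)) ->
  (forall (c : R) (f : T -> \bar R), (0 <= c)%R -> measurable_fun setT f ->
    (forall x, 0 <= f x) -> P f -> P (fun x => c%:E * f x)) ->
  (forall f_ : (T -> \bar R)^nat, (forall n, measurable_fun setT (f_ n)) ->
    (forall n x, 0 <= f_ n x) -> (forall x, nondecreasing_seq (f_ ^~ x)) ->
    (forall n, P (f_ n)) -> P (fun x => limn (f_ ^~ x))) ->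
  forall f, measurable_fun setT f -> (forall x, 0 <= f x) -> P f.
Proof.
move=> Pind Padd Pscale Plim f mf f0.
pose f_ := nnsfun_approx measurableT mf.
have -> : f = fun x => limn (fun n => (f_ n x)%:E).
  by apply/funext => x; apply/esym/cvg_lim => //; exact: cvg_nnsfun_approx.
apply: Plim => [n|n x|x a b ab|n].
- exact/measurable_EFinP.
- by rewrite lee_fin.
- by rewrite lee_fin; exact/lefP/nd_nnsfun_approx.
- set g := f_ n.
  have -> : (fun x => (g x)%:E) = fun x =>
      \sum_(i <- finmap.enum_fset (fset_set (range g))) i%:E * (\1_(g @^-1` [set i]) x)%:E.
    apply/funext => x; rewrite fimfunE -fsumEFin// fsbig_finite//=.
  have : {in finmap.enum_fset (fset_set (range g)), forall i : R, 0 <= i}%R.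
    by move=> i; rewrite in_fset_set// inE => -[x _ <-].
  have mg (i : R) : measurable (g @^-1` [set i]) by exact: measurable_funPTI.
  elim: (finmap.enum_fset _) => [_|i s IH i0].
    have := Pind _ measurable0; congr P; apply/funext => x.
    by rewrite big_nil indicE in_set0.
  have ms (s' : seq R) : measurable_fun setT (fun x =>
      \sum_(i <- s') i%:E * (\1_(g @^-1` [set i]) x)%:E).
    apply: emeasurable_sum => j; apply: measurable_funeM; exact/measurable_EFinP.
  have i_ge0 : (0 <= i)%R by apply: i0; rewrite mem_head.
  have s0 x : 0 <= \sum_(i <- s) i%:E * (\1_(g @^-1` [set i]) x)%:E.
    rewrite big_seq sume_ge0// => j js; rewrite mule_ge0// lee_fin//.
    by apply: i0; rewrite inE js orbT.
  have := Padd (fun x => i%:E * (\1_(g @^-1` [set i]) x)%:E)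
    (fun x => \sum_(i <- s) i%:E * (\1_(g @^-1` [set i]) x)%:E).
  have -> : (fun x => \sum_(i0 <- i :: s) i0%:E * (\1_(g @^-1` [set i0]) x)%:E) =
    (fun x => i%:E * (\1_(g @^-1` [set i]) x)%:E +
      \sum_(i <- s) i%:E * (\1_(g @^-1` [set i]) x)%:E).
    by apply/funext => x; rewrite big_cons.
  apply => //.
  + by apply: measurable_funeM; exact/measurable_EFinP.
  + by move=> x; rewrite mule_ge0// lee_fin.
  + apply: Pscale => //; [exact/measurable_EFinP|exact: Pind].
  + by apply: IH => j js; apply: i0; rewrite inE js orbT.
Qed.

End monotone_class.

Section functional_markov.
Context (R : realType) (D : set R) (d : measure_display)
  (E : measurableType d) (d' : measure_display) (Omega : measurableType d')
  (Z : markov_process D E Omega).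
Hypothesis DI : is_interval D.

(** [Omega] with the events observable during [I] as measurable sets, so that
    being a functional of this time interval is measurability on this type. *)
Definition obs_space (I : set R) := g_sigma_algebraType (obs Z I).

Notation future t := (D `&` `[t, +oo[).

Lemma is_interval_future t : is_interval (future t).
Proof.
move=> x y /= [Dx tx] [Dy ty] z xzy; split; first exact: DI xzy.
move: tx; rewrite /= !in_itv/= !andbT => tx.
by case/andP: xzy => xz _; exact: le_trans xz.
Qed.

Lemma past_subset r t : D r -> D t -> `[r, t] `<=` D.
Proof. by move=> Dr Dt x; rewrite /= in_itv/=; exact: DI. Qed.

Lemma measurable_obs_spaceE I : is_interval I -> I `<=` D ->
  forall C : set Omega, measurable (C : set (obs_space I)) = obs Z I C.
Proof.
move=> II ID C; rewrite (@measurable_g_measurableTypeE _ (obs Z I))//.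
exact: obs_sigma_algebra.
Qed.

Lemma measurable_obs_id I : is_interval I -> I `<=` D ->
  measurable_fun [set: Omega] (id : Omega -> obs_space I).
Proof.
move=> II ID _ B; rewrite measurable_obs_spaceE// setTI.
exact: obs_measurable.
Qed.

Lemma measurable_fun_obs_space I d2 (Y : measurableType d2) (f : Omega -> Y) :
  is_interval I -> I `<=` D -> measurable_fun [set: obs_space I] f ->
  measurable_fun [set: Omega] f.
Proof. by move=> II ID mf; apply: (measurableT_comp mf); exact: measurable_obs_id. Qed.

Lemma measurable_obs_space_sub I I' d2 (Y : measurableType d2) (f : Omega -> Y) :
  is_interval I -> is_interval I' -> I `<=` I' -> I' `<=` D ->
  measurable_fun [set: obs_space I] f -> measurable_fun [set: obs_space I'] f.
Proof.
move=> iI iI' sI sI' mf _ B mB; rewrite measurable_obs_spaceE//.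
apply: (obs_subset iI iI') => //; rewrite -measurable_obs_spaceE//.
  exact: mf.
exact: subset_trans sI'.
Qed.

Lemma measurable_state I t : is_interval I -> I `<=` D -> I t ->
  measurable_fun [set: obs_space I] (Z t).
Proof.
by move=> II ID It _ B mB; rewrite setTI measurable_obs_spaceE//; exact: state_obs.
Qed.

Lemma measurable_stateT t : D t -> measurable_fun [set: Omega] (Z t).
Proof.
by move=> Dt; apply: (measurable_fun_obs_space DI (@subset_refl _ D)); exact: measurable_state.
Qed.

Lemma measurable_fun_law t (G : Omega -> \bar R) : D t ->
  measurable_fun [set: obs_space (future t)] G -> (forall w, 0 <= G w) ->
  measurable_fun [set: E] (fun x => \int[law Z t x]_w G w).
Proof.
move=> Dt mG G0.
have iF := @is_interval_future t.
have FD : future t `<=` D by move=> ? [].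
have mid := measurable_obs_id iF FD.
have -> : (fun x => \int[law Z t x]_w G w) =
    fun x => \int[pushforward (law Z t x) (id : Omega -> obs_space (future t))]_w G w.
  by apply/funext => x; rewrite ge0_integral_pushforward.
apply: measurable_fun_integral_kernel => // U; rewrite measurable_obs_spaceE// => mU.
exact: law_measurable.
Qed.

(** Both sides are additive, positively homogeneous and monotonically
    continuous in [G], and they agree on indicators by [law_markov]. *)
Lemma law_markov_indic (r t : R) x C (G : Omega -> \bar R) :
  D r -> D t -> (r <= t)%R -> obs Z `[r, t] C ->
  measurable_fun [set: obs_space (future t)] G -> (forall w, 0 <= G w) ->
  \int[law Z r x]_(w in C) G w =
  \int[law Z r x]_(w in C) \int[law Z t (Z t w)]_w' G w'.
Proof.
move=> Dr Dt rt oC mG G0.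
have mC : measurable C.
  apply: obs_measurable oC; first exact: interval_is_interval.
  exact: past_subset.
have iF := @is_interval_future t.
have FD : future t `<=` D by move=> ? [].
have mT (g : Omega -> \bar R) : measurable_fun [set: obs_space (future t)] g ->
    measurable_fun [set: Omega] g by exact: measurable_fun_obs_space.
have mC' (g : Omega -> \bar R) : measurable_fun [set: obs_space (future t)] g ->
    measurable_fun C g by move=> /mT; exact: measurable_funTS.
have mL (g : Omega -> \bar R) : measurable_fun [set: obs_space (future t)] g ->
    (forall w, 0 <= g w) ->
    measurable_fun C (fun w => \int[law Z t (Z t w)]_w' g w').
  move=> mg g0; apply: measurable_funTS.
  apply: (measurableT_comp (f := fun x => \int[law Z t x]_w' g w')).
    exact: measurable_fun_law.
  exact: measurable_stateT.
move: G mG G0; apply: (@ge0_measurable_fun_ind _ (obs_space (future t)) R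
   (fun G => \int[law Z r x]_(w in C) G w =
   \int[law Z r x]_(w in C) \int[law Z t (Z t w)]_w' G w')).
- move=> B; rewrite measurable_obs_spaceE// => oB.
  have mB : measurable (B : set Omega) by exact: obs_measurable oB.
  rewrite integral_indic// 1?setIC.
  apply: (etrans (law_markov x Dr Dt rt oC oB)).
  by apply: eq_integral => w _; rewrite integral_indic// setIT.
- move=> f g mf mg f0 g0 Pf Pg.
  rewrite ge0_integralD//; [|exact: mC'|exact: mC'].
  rewrite Pf Pg -ge0_integralD//.
  + apply: eq_integral => w _; rewrite ge0_integralD//; exact: mT.
  + by move=> w _; exact: integral_ge0.
  + exact: mL.
  + by move=> w _; exact: integral_ge0.
  + exact: mL.
- move=> c f c0 mf f0 Pf.
  rewrite ge0_integralZl//; [|exact: mC'].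
  rewrite Pf -ge0_integralZl//.
  + apply: eq_integral => w _; rewrite ge0_integralZl//; exact: mT.
  + exact: mL.
  + by move=> w _; exact: integral_ge0.
- move=> f_ mf f0 ndf Pf.
  rewrite monotone_convergence//; last by move=> n; exact: mC'.
  transitivity (limn (fun n => \int[law Z r x]_(w in C) \int[law Z t (Z t w)]_w' f_ n w')).
    by congr (limn _); apply/funext => n; exact: Pf.
  rewrite -monotone_convergence//.
  + apply: eq_integral => w _; rewrite monotone_convergence//.
    by move=> n; exact: mT.
  + by move=> n; exact: mL.
  + by move=> n w _; exact: integral_ge0.
  + move=> w _ a b ab; apply: ge0_le_integral => //.
    * exact: mT.
    * exact: mT.
    * by move=> w' _; exact: ndf.
Qed.

(** The same argument as for [law_markov_indic], now in [H]. *)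
Lemma law_markov_fun (r t : R) x (H G : Omega -> \bar R) :
  D r -> D t -> (r <= t)%R ->
  measurable_fun [set: obs_space `[r, t]] H -> (forall w, 0 <= H w) ->
  measurable_fun [set: obs_space (future t)] G -> (forall w, 0 <= G w) ->
  \int[law Z r x]_w (H w * G w) =
  \int[law Z r x]_w (H w * \int[law Z t (Z t w)]_w' G w').
Proof.
move=> Dr Dt rt mH H0 mG G0.
have pD := past_subset Dr Dt.
have pI : is_interval (`[r, t]%classic : set R) by exact: interval_is_interval.
have FD : future t `<=` D by move=> ? [].
have iF := @is_interval_future t.
have mGT : measurable_fun [set: Omega] G by exact: measurable_fun_obs_space mG.
pose LG w := \int[law Z t (Z t w)]_w' G w'.
have mLG : measurable_fun [set: Omega] LG.
  apply: (measurableT_comp (f := fun x => \int[law Z t x]_w' G w')).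
    exact: measurable_fun_law.
  exact: measurable_stateT.
have LG0 w : 0 <= LG w by exact: integral_ge0.
have mT (g : Omega -> \bar R) : measurable_fun [set: obs_space `[r, t]] g ->
    measurable_fun [set: Omega] g by exact: measurable_fun_obs_space.
move: H mH H0; apply: (@ge0_measurable_fun_ind _ (obs_space `[r, t]) R
   (fun H => \int[law Z r x]_w (H w * G w) = \int[law Z r x]_w (H w * LG w))).
- move=> B; rewrite measurable_obs_spaceE// => oB.
  have mB : measurable (B : set Omega) by exact: obs_measurable oB.
  have E1 (K : Omega -> \bar R) : \int[law Z r x]_w ((\1_B w)%:E * K w) =
      \int[law Z r x]_(w in (B : set Omega)) K w.
    rewrite [RHS]integral_mkcond; apply: eq_integral => w _.
    by rewrite epatch_indic muleC.
  by rewrite !E1; exact: law_markov_indic.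
- move=> f g mf mg f0 g0 Pf Pg.
  have E1 (K : Omega -> \bar R) : (forall w, 0 <= K w) -> measurable_fun [set: Omega] K ->
      \int[law Z r x]_w ((f w + g w) * K w) =
      \int[law Z r x]_w (f w * K w) + \int[law Z r x]_w (g w * K w).
    move=> K0 mK; rewrite -ge0_integralD//.
    + by apply: eq_integral => w _; rewrite ge0_muleDl.
    + by move=> w _; exact: mule_ge0.
    + apply: emeasurable_funM => //; exact: mT.
    + by move=> w _; exact: mule_ge0.
    + apply: emeasurable_funM => //; exact: mT.
  by rewrite !E1// Pf Pg.
- move=> c f c0 mf f0 Pf.
  have E1 (K : Omega -> \bar R) : (forall w, 0 <= K w) -> measurable_fun [set: Omega] K ->
      \int[law Z r x]_w (c%:E * f w * K w) =
      c%:E * \int[law Z r x]_w (f w * K w).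
    move=> K0 mK; rewrite -ge0_integralZl//.
    + by apply: eq_integral => w _; rewrite muleA.
    + apply: emeasurable_funM => //; exact: mT.
    + by move=> w _; exact: mule_ge0.
  by rewrite !E1// Pf.
- move=> f_ mf f0 ndf Pf.
  have E1 (K : Omega -> \bar R) : (forall w, 0 <= K w) -> measurable_fun [set: Omega] K ->
      \int[law Z r x]_w (limn (f_ ^~ w) * K w) =
      limn (fun n => \int[law Z r x]_w (f_ n w * K w)).
    move=> K0 mK; rewrite -monotone_convergence//.
    + apply: eq_integral => w _.
      have cf : cvgn (f_ ^~ w) by apply: ereal_nondecreasing_is_cvgn; exact: ndf.
      (* The product is not continuous at an infinite factor, so that the case
         K w = +oo is separate. *)
      have [->|Kfin] := eqVneq (K w) +oo; last first.
        have Kf : K w \is a fin_num by rewrite ge0_fin_numE// lt_neqAle Kfin leey.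
        by rewrite muleC -limeMl//; congr (limn _); apply/funext => n; rewrite muleC.
      have [/eqP l0|ln0] := boolP (limn (f_ ^~ w) == 0).
        rewrite l0 mul0e; apply/esym.
        have fn0 n : f_ n w = 0.
          apply/eqP; rewrite eq_le f0 andbT -l0.
          by apply: lime_ge => //; exists n => // m /= nm; exact: ndf.
        by under eq_fun do rewrite fn0 mul0e; rewrite lim_cst.
      have l0 : 0 < limn (f_ ^~ w).
        rewrite lt0e ln0 lime_ge//; exact: nearW.
      rewrite gt0_muley//; apply/esym/cvg_lim => //.
      have [N fN] : exists N, 0 < f_ N w.
        apply/not_existsP => fn; move: l0; rewrite ltNge => /negP; apply.
        by apply: lime_le => //; apply: nearW => n; rewrite leNgt; apply/negP.
      apply: cvg_near_cst; near=> n; apply/eqP; rewrite gt0_muley//.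
      apply: (lt_le_trans fN); apply: ndf.
      by near: n; exists N.
    + by move=> n; apply: emeasurable_funM => //; exact: mT.
    + by move=> n w _; exact: mule_ge0.
    + by move=> w _ a b ab; rewrite lee_wpmul2r//; exact: ndf.
  by rewrite !E1//; congr (limn _); apply/funext => n; exact: Pf.
Unshelve. all: by end_near. Qed.

Lemma law_markov_mean (r t : R) x (G : Omega -> \bar R) :
  D r -> D t -> (r <= t)%R ->
  measurable_fun [set: obs_space (future t)] G -> (forall w, 0 <= G w) ->
  \int[law Z r x]_w G w =
  \int[law Z r x]_w \int[law Z t (Z t w)]_w' G w'.
Proof.
move=> Dr Dt rt mG G0.
have E1 (K : Omega -> \bar R) : \int[law Z r x]_w (cst 1 w * K w) = \int[law Z r x]_w K w.
  by apply: eq_integral => w _; rewrite mul1e.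
rewrite -[LHS]E1 -[RHS]E1; apply: law_markov_fun => //; exact: measurable_cst.
Qed.

Lemma law_initial_int (r : R) x (f : E -> \bar R) : D r ->
  measurable_fun [set: E] f -> (forall y, 0 <= f y) ->
  \int[law Z r x]_w f (Z r w) = f x.
Proof.
move=> Dr mf f0; have mZ := measurable_stateT Dr.
transitivity (\int[pushforward (law Z r x) (Z r)]_y f y).
  by rewrite ge0_integral_pushforward.
rewrite -[RHS]mul1e -(@diracT _ _ R x) -integral_dirac//.
by apply: eq_measure_integral => B mB _; rewrite /= /pushforward law_initial.
Qed.

End functional_markov.

(** * Joint measurability of right-continuous paths *)

Section joint_measurability.
Context (R : realType).

(** The first point of the grid of mesh 1 / (n + 1) that is strictly greater
    than q: a limit from the right excludes q itself. *)
Definition grid_above (n : nat) (q : R) : R :=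
  ((Num.floor (q * n.+1%:R) + 1)%:~R / n.+1%:R)%R.

Lemma grid_above_gt n q : (q < grid_above n q)%R.
Proof. by rewrite /grid_above ltr_pdivlMr// floorD1_gt. Qed.

Lemma grid_above_cvg q : grid_above n q @[n --> \oo] --> q.
Proof.
have H n : (q <= grid_above n q <= q + n.+1%:R^-1)%R.
  rewrite (ltW (grid_above_gt _ _))/= /grid_above ler_pdivrMr// mulrDl mulVf//.
  by rewrite intrD lerD2r floor_le.
apply: (@squeeze_cvgr _ _ _ _ (cst q) (fun n => q + n.+1%:R^-1)%R).
- by apply: nearW => n; exact: H.
- exact: cvg_cst.
- rewrite -[X in _ --> X]addr0; apply: cvgD; first exact: cvg_cst.
  exact: cvg_harmonic.
Qed.

(** The time takes countably many values, each on an interval: the preimage of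
    a measurable set is a countable union of measurable rectangles. *)
Lemma measurable_fun_grid_above d (T : measurableType d) n (f : R -> T -> \bar R) :
  (forall q, measurable_fun [set: T] (f q)) ->
  measurable_fun [set: measurableTypeR R * T]
    (fun p => f (grid_above n p.1) p.2).
Proof.
move=> mf _ B mB; rewrite setTI.
pose F (j : int) : set (measurableTypeR R * T) :=
  `[(j%:~R / n.+1%:R)%R, ((j + 1)%:~R / n.+1%:R)%R[%classic `*`
  (f ((j + 1)%:~R / n.+1%:R)%R @^-1` B).
rewrite (_ : _ @^-1` _ = \bigcup_j F j).
  apply: countable_bigcupT_measurable => // j.
  apply: measurableX; first exact: measurable_itv.
  by rewrite -[X in measurable X]setTI; exact: mf.
have FE j (q : R) : (q \in `[(j%:~R / n.+1%:R)%R, ((j + 1)%:~R / n.+1%:R)%R[) =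
    (Num.floor (q * n.+1%:R)%R == j).
  by rewrite in_itv/= floor_eq ler_pdivrMr// ltr_pdivlMr.
apply/seteqP; split => [[q w]/= Bqw|[q w] [j _ [/= +]]].
  exists (Num.floor (q * n.+1%:R)%R) => //; split => //=.
  by have := FE (Num.floor (q * n.+1%:R)%R) q; rewrite eqxx.
by rewrite FE => /eqP <-.
Qed.

(** An open set of [S] is the set where a continuous function is positive,
    namely the distance to the complement in the ambient metric space. Along the
    path this function is the limit of its values at the next grid points. *)
Lemma right_continuous_measurable (S : ptopologicalType) d (T : measurableType d)
    (Y : R -> T -> borel S) :
  metrizable_luzin R S ->
  (forall q, measurable_fun [set: T] (Y q)) ->
  (forall q w, Y s w @[s --> q^'+] --> (Y q w : S)) ->
  measurable_fun [set: measurableTypeR R * T] (fun p => Y p.1 p.2).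
Proof.
move=> [K [e [_ _ opE _]]] mY cY.
apply: (measurability (@open S : set (set (borel S)))) => //.
move=> _ [U oU <-].
have [V oV UV] := (opE U).1 oU.
pose g (y : S) := edist_inf (~` V) (e y).
have ce : continuous e.
  by apply/continuousP => W oW; apply/opE; exists W.
have cg : continuous g.
  move=> y; apply: (@continuous_comp _ _ _ e (edist_inf (~` V))); first exact: ce.
  exact: edist_inf_continuous.
have UE : U = [set y | 0 < g y].
  rewrite UV; apply/seteqP; split => y /=; last first.
    by apply: contraPP => nV; rewrite /g edist_inf0// ltxx.
  move=> Vy; have : nbhs (e y) V by exact: open_nbhs_nbhs.
  move=> /nbhs_ballP[eps eps0 ballV].
  apply: (@lt_le_trans _ _ eps%:E); first by rewrite lte_fin.
  apply: le_ereal_inf_tmp => _ [k nVk <-].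
  by rewrite leNgt; apply/negP => /edist_lt_ball /= /ballV.
pose G p := g (Y p.1 p.2).
have mg : measurable_fun [set: borel S] (g : borel S -> \bar R).
  apply: (measurability _ (ErealGenOInfty.measurableE R)) => // _ [_ [x ->] <-].
  rewrite setTI; apply: sub_sigma_algebra.
  apply: (@open_comp _ _ g); first by move=> ? _; exact: cg.
  rewrite (_ : `]x%:E, +oo[%classic = [set y | x%:E < y]); first exact: open_ereal_gt_ereal.
  by apply/seteqP; split => y /=; rewrite in_itv/= andbT.
have mG : measurable_fun [set: measurableTypeR R * T] G.
  apply: (@emeasurable_fun_cvg _ _ _ _
    (fun n p => g (Y (grid_above n p.1) p.2))).
    move=> n.
    apply: (@measurable_fun_grid_above _ T n (fun q w => g (Y q w))) => q.
    exact: measurableT_comp mg (mY q).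
  move=> [q w] _ /=; rewrite /G/=.
  apply: (@continuous_cvg _ _ _ _ _ (fun n => Y (grid_above n q) w : S) g (Y q w)).
    exact: cg.
  apply: (@cvg_comp _ _ _ (grid_above ^~ q) (fun s => Y s w : S) _ _ _ _ (cY q w)).
  move=> P; rewrite /at_right /within/= => nP.
  have H : \forall n \near \oo, (q < grid_above n q)%R -> P (grid_above n q).
    exact: (@grid_above_cvg q _ nP).
  rewrite /= /fmap/=; apply: filterS H => n; apply.
  exact: grid_above_gt.
rewrite (_ : _ @^-1` _ = G @^-1` `]0, +oo[%classic).
  by apply: mG => //; exact: emeasurable_itv.
by rewrite UE; apply/seteqP; split => p /=; rewrite in_itv/= andbT.
Qed.
End joint_measurability.

(** * The branching term along a path *)

Section evolution_equation.
Context (R : realType) (S : ptopologicalType)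
  (dO : measure_display) (Omega : measurableType dO)
  (beta : R) (eta : {mfun borel S >-> R})
  (Z : markov_process (Rplus R) (borel S) Omega).
Hypotheses (hS : metrizable_luzin R S) (hZ : right_process Z).
Hypotheses (beta_gt0 : (0 < beta)%R) (eta_gt0 : forall y, (0 < eta y)%R).

Definition future_space (s : R) := obs_space Z (Rplus R `&` `[s, +oo[).

Lemma is_interval_Rplus : is_interval (Rplus R).
Proof. exact: interval_is_interval. Qed.
Hint Resolve is_interval_Rplus : core.

Lemma RplusP (s : R) : (0 <= s)%R -> Rplus R s.
Proof. by move=> s0; rewrite /= in_itv/= s0. Qed.

Lemma future_sub s : Rplus R `&` `[s, +oo[ `<=` Rplus R.
Proof. by move=> ? []. Qed.

Lemma measurable_state_future (s q : R) : (0 <= s <= q)%R ->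
  measurable_fun [set: future_space s] (Z q).
Proof.
move=> /andP[s0 sq]; apply: measurable_state.
- exact: is_interval_future.
- exact: future_sub.
- split; first by apply: RplusP; exact: le_trans sq.
  by rewrite /= in_itv/= sq.
Qed.

Lemma measurable_future_space d (Y : measurableType d) s (f : Omega -> Y) :
  measurable_fun [set: future_space s] f -> measurable_fun [set: Omega] f.
Proof.
apply: measurable_fun_obs_space; last exact: future_sub.
exact: is_interval_future.
Qed.

Lemma measurable_future_space_le d (Y : measurableType d) (s s' : R) (f : Omega -> Y) :
  (s' <= s)%R ->
  measurable_fun [set: future_space s] f -> measurable_fun [set: future_space s'] f.
Proof.
move=> ss'; apply: measurable_obs_space_sub.
- exact: is_interval_future.
- exact: is_interval_future.
- move=> q [Dq]; rewrite /= in_itv/= andbT => sq; split; first exact: Dq.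
  by rewrite /= in_itv/= andbT (le_trans ss').
- exact: future_sub.
Qed.

Lemma measurable_state_ge0 (s : R) : (0 <= s)%R -> measurable_fun [set: Omega] (Z s).
Proof.
by move=> s0; apply: (@measurable_future_space _ _ s); apply: measurable_state_future; rewrite s0 lexx.
Qed.

(** Held at Z_s0 before time s0, the path is right-continuous on the whole line
    and depends on the future of s0 only. *)
Lemma measurable_path (s0 : R) : (0 <= s0)%R ->
  measurable_fun [set: measurableTypeR R * future_space s0]
    (fun p => Z (Num.max p.1 s0) p.2).
Proof.
move=> s00.
apply: (@right_continuous_measurable R S _ (future_space s0)
  (fun q w => Z (Num.max q s0) w)) => // [q|q w].
  by apply: measurable_state_future; rewrite s00/= le_max lexx orbT.
have [qs0|s0q] := ltP q s0.
  apply: cvg_near_cst.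
  near=> s; rewrite max_r//; near: s.
  exact: nbhs_right_le.
have cZ := (hZ.1 w).1 q (le_trans s00 s0q).
apply: cvg_trans cZ; apply: near_eq_cvg; near=> s.
rewrite max_l//; apply: (le_trans s0q); apply: ltW; near: s.
exact: nbhs_right_gt.
Unshelve. all: by end_near. Qed.

(** The density of psi(Z_s, u(s, Z_s)) K(ds) with respect to ds, at y = Z_s. *)
Definition branching_rate (u : R -> borel S -> R) (s : R) (y : borel S) : R :=
  (u s y `^ (1 + beta) / (beta * eta y `^ beta))%R.

Definition branching_loss (u : R -> borel S -> R) (a b : R) (w : Omega) : \bar R :=
  \int[@lebesgue_measure R]_(s in `[a, b]) (branching_rate u s (Z s w))%:E.

Lemma branching_rate_ge0 u s y : (0 <= branching_rate u s y)%R.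
Proof. by rewrite divr_ge0 ?powR_ge0// mulr_ge0 ?powR_ge0// ltW. Qed.

Lemma branching_loss_ge0 u a b w : 0 <= branching_loss u a b w.
Proof. by apply: integral_ge0 => s _; rewrite lee_fin branching_rate_ge0. Qed.

Section measurability.
Variables (u : R -> borel S -> R) (t : R).
Hypothesis mu : measurable_fun (`[0%R, t] `*` [set: borel S])
  (fun p : measurableTypeR R * borel S => u p.1 p.2).

Let rate_path a b (p : R * Omega) : \bar R :=
  ((fun p => (branching_rate u p.1 (Z p.1 p.2))%:E) \_ (`[a, b] `*` [set: Omega])) p.

Lemma measurable_rate :
  measurable_fun (`[0%R, t] `*` [set: borel S])
    (fun p : measurableTypeR R * borel S => branching_rate u p.1 p.2).
Proof.
have meta : measurable_fun (`[0%R, t] `*` [set: borel S])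
    (fun p : measurableTypeR R * borel S => eta p.2).
  apply: measurable_funTS; exact: measurableT_comp.
rewrite (_ : (fun p => _) = fun p =>
    (u p.1 p.2 `^ (1 + beta) * (beta^-1 * eta p.2 `^ (- beta)))%R); last first.
  by apply/funext => p; rewrite /branching_rate invfM powRN.
apply: measurable_funM; first exact: measurableT_comp (measurable_powR _) mu.
by apply: measurable_funM => //; exact: measurableT_comp (measurable_powR _) meta.
Qed.

Lemma measurable_rate_path (a b : R) : (0 <= a)%R -> (b <= t)%R ->
  measurable_fun [set: measurableTypeR R * future_space a] (rate_path a b).
Proof.
move=> a0 bt.
have mD : measurable (`[a, b] `*` [set: Omega] : set (measurableTypeR R * future_space a)).
  by apply: measurableX => //; exact: measurable_itv.
apply/(measurable_restrictT _ mD).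
apply/measurable_EFinP.
apply: (eq_measurable_fun
  (fun p : measurableTypeR R * future_space a =>
     branching_rate u p.1 (Z (Num.max p.1 a) p.2))).
  move=> [q w]; rewrite inE/= in_itv/= => -[/andP[aq _] _].
  by rewrite max_l.
apply: (measurable_comp (F := `[0%R, t] `*` [set: borel S])
  (f := fun p : measurableTypeR R * borel S => branching_rate u p.1 p.2)
  (g := fun p : measurableTypeR R * future_space a => (p.1, Z (Num.max p.1 a) p.2))).
- by apply: measurableX => //; exact: measurable_itv.
- move=> _ [[q w] [/= + _] <-]; rewrite in_itv/= => /andP[aq qb]; split => //=.
  by rewrite in_itv/= (le_trans a0 aq) (le_trans qb bt).
- exact: measurable_rate.
- apply: measurable_funTS; apply/measurable_fun_pairP; split => /=.
    exact: measurable_fst.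
  exact: measurable_path.
Qed.

Lemma measurable_rate_pathT (a b : R) : (0 <= a)%R -> (b <= t)%R ->
  measurable_fun [set: measurableTypeR R * Omega] (rate_path a b).
Proof.
move=> a0 bt.
apply: (measurableT_comp (f := rate_path a b : measurableTypeR R * future_space a -> \bar R)
  (g := fun p : measurableTypeR R * Omega => (p.1, p.2 : future_space a))).
  exact: measurable_rate_path.
apply/measurable_fun_pairP; split => /=; first exact: measurable_fst.
apply: (measurableT_comp (f := id : Omega -> future_space a)).
  apply: measurable_obs_id; last exact: future_sub.
  exact: is_interval_future.
exact: measurable_snd.
Qed.

Lemma branching_lossE a b w :
  branching_loss u a b w = \int[@lebesgue_measure R]_s rate_path a b (s, w).
Proof.
rewrite /branching_loss integral_mkcond; apply: eq_integral => s _.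
by rewrite /rate_path /patch/= in_setX in_setT andbT.
Qed.

Lemma rate_path_ge0 a b p : 0 <= rate_path a b p.
Proof.
by rewrite /rate_path patchE; case: ifP => // _; rewrite lee_fin branching_rate_ge0.
Qed.

(** As a functional of the future of s, the branching term is within reach of
    the Markov property at time s. *)
Lemma measurable_branching_loss (s a b : R) : (0 <= s)%R -> (s <= a)%R -> (b <= t)%R ->
  measurable_fun [set: future_space s] (branching_loss u a b).
Proof.
move=> s0 sa bt; apply: measurable_future_space_le (sa) _.
rewrite (_ : branching_loss u a b =
    fubini_G (@lebesgue_measure R) (rate_path a b)); last first.
  by apply/funext => w; rewrite branching_lossE.
apply: (@measurable_fun_fubini_tonelli_G _ _ (measurableTypeR R) (future_space a)).
  by apply: measurable_rate_path => //; exact: le_trans sa.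
exact: rate_path_ge0.
Qed.

Lemma branching_loss_tonelli (r : R) z (a b : R) : (0 <= a)%R -> (b <= t)%R ->
  \int[law Z r z]_w branching_loss u a b w =
  \int[@lebesgue_measure R]_(s in `[a, b])
    \int[law Z r z]_w (branching_rate u s (Z s w))%:E.
Proof.
move=> a0 bt.
have mT := measurable_rate_pathT a0 bt.
under eq_integral do rewrite branching_lossE.
have rp0 p : 0 <= rate_path a b p by exact: rate_path_ge0.
rewrite -(fubini_tonelli (m1 := @lebesgue_measure R) (m2 := law Z r z) _ mT rp0).
rewrite [RHS]integral_mkcond; apply: eq_integral => s _.
rewrite patchE; case: ifPn => sab.
  by apply: eq_integral => w _; rewrite /rate_path patchE in_setX sab in_setT.
by rewrite integral0_eq// => w _; rewrite /rate_path patchE in_setX (negbTE sab).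
Qed.

Lemma measurable_rate_time (a b : R) w : (0 <= a)%R -> (b <= t)%R ->
  measurable_fun (`[a, b] : set (measurableTypeR R))
    (fun s => (branching_rate u s (Z s w))%:E).
Proof.
move=> a0 bt.
have mab : measurable (`[a, b] : set (measurableTypeR R)) by exact: measurable_itv.
apply/(measurable_restrictT _ mab).
rewrite (_ : _ \_ _ = fun s => rate_path a b (s, w)); last first.
  by apply/funext => s; rewrite /rate_path !patchE in_setX in_setT andbT.
apply: (measurableT_comp (f := rate_path a b : measurableTypeR R * future_space a -> \bar R)).
  exact: measurable_rate_path.
exact: pair2_measurable.
Qed.

Lemma branching_loss_split (a b c : R) w : (0 <= a)%R -> (a <= b <= c)%R -> (c <= t)%R ->
  branching_loss u a c w = branching_loss u a b w + branching_loss u b c w.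
Proof.
move=> a0 /andP[ab bc] ct.
have mac := measurable_rate_time w a0 ct.
rewrite /branching_loss -(integral_itv_bndo_bndc (r := b)).
rewrite -ge0_integral_setU//=.
- congr integral; apply/seteqP; split => s /=; rewrite !in_itv/=.
    move=> /andP[as_ sc]; have [sb|bs] := ltP s b; first by left; rewrite as_.
    by right; rewrite sc.
  move=> [/andP[as_ sb]|/andP[bs sc]].
    by rewrite as_ (le_trans (ltW sb)).
  by rewrite sc (le_trans ab).
- apply: measurable_funS mac; first exact: measurable_itv.
  move=> s /=; rewrite !in_itv/= => -[/andP[as_ sb]|/andP[bs sc]].
    by rewrite as_ (le_trans (ltW sb)).
  by rewrite sc (le_trans ab).
- by move=> s _; rewrite lee_fin branching_rate_ge0.
- rewrite disj_set2E; apply/eqP/seteqP; split => // s /= [].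
  by rewrite !in_itv/= => /andP[_ sb] /andP[+ _]; rewrite leNgt sb.
- apply: measurable_funS mac; first exact: measurable_itv.
  by move=> s /=; rewrite !in_itv/= => /andP[-> sb]; rewrite (le_trans (ltW sb)).
Qed.

Lemma measurable_mean_rate (r : R) z (a b : R) : (0 <= a)%R -> (b <= t)%R ->
  measurable_fun (`[a, b] : set (measurableTypeR R))
    (fun s => \int[law Z r z]_w (branching_rate u s (Z s w))%:E).
Proof.
move=> a0 bt.
have mab : measurable (`[a, b] : set (measurableTypeR R)) by exact: measurable_itv.
apply/(measurable_restrictT _ mab).
rewrite (_ : _ \_ _ = fubini_F (law Z r z) (rate_path a b)); last first.
  apply/funext => s; rewrite /fubini_F patchE; case: ifPn => sab.
    by apply: eq_integral => w _; rewrite /rate_path patchE in_setX sab in_setT.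
  by rewrite integral0_eq// => w _; rewrite /rate_path patchE in_setX (negbTE sab).
apply: measurable_fun_fubini_tonelli_F; last exact: rate_path_ge0.
exact: measurable_rate_pathT.
Qed.

End measurability.

End evolution_equation.
Arguments measurable_branching_loss {R S dO Omega beta eta Z} hS hZ beta_gt0 {u t} mu.
Arguments branching_loss_tonelli {R S dO Omega beta eta Z} hS hZ beta_gt0 {u t} mu.
Arguments measurable_mean_rate {R S dO Omega beta eta Z} hS hZ beta_gt0 {u t} mu.
Arguments branching_loss_split {R S dO Omega beta eta Z} hS hZ beta_gt0 {u t} mu.
Arguments measurable_rate_time {R S dO Omega beta eta Z} hS hZ {u t} mu.

(** * Decay of the solutions of the evolution equation *)

Section integral_of_difference.
Context {R : realType}.

Lemma bounded_integrable d (T : measurableType d) (P : probability T R) (f : T -> R) (M : R) :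
  measurable_fun setT f -> (forall x, 0 <= f x <= M)%R ->
  P.-integrable setT (EFin \o f).
Proof.
move=> mf fM; apply: (@le_integrable _ _ _ P setT measurableT _ (cst M%:E)).
- exact/measurable_EFinP.
- move=> x _; case/andP: (fM x) => f0 fx /=.
  by rewrite lee_fin !ger0_norm// (le_trans f0).
- exact: finite_measure_integrable_cst.
Qed.

(** The value [c] being finite, [I] is integrable, and the integral can be
    split. The subtraction is moved to the other side because the resulting
    identity has nonnegative terms. *)
Lemma integral_sub_eq d (T : measurableType d) (P : probability T R)
    (f : T -> R) (I : T -> \bar R) (M c : R) :
  measurable_fun setT f -> (forall x, 0 <= f x <= M)%R ->
  measurable_fun setT I -> (forall x, 0 <= I x) ->
  c%:E = \int[P]_x ((f x)%:E - I x) ->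
  \int[P]_x (f x)%:E = c%:E + \int[P]_x I x.
Proof.
move=> mf fM mI I0 cE.
have intf := bounded_integrable P mf fM.
pose g x := (f x)%:E - I x.
have mg : measurable_fun setT g.
  by apply: emeasurable_funB => //; exact/measurable_EFinP.
have pos_lty : \int[P]_x g^\+ x < +oo.
  apply: (@le_lt_trans _ _ (\int[P]_x (f x)%:E)).
    apply: ge0_le_integral => //.
    - exact: measurable_funepos.
    - exact/measurable_EFinP.
    - move=> x _; rewrite funeposE ge_max /g; case/andP: (fM x) => f0 _.
      rewrite lee_fin f0 andbT; case: (I x) (I0 x) => [i| |]//=.
        by rewrite -EFinB !lee_fin => i0; rewrite gerBl.
      by rewrite addeNy leNye.
  case/integrableP: intf => _; apply: le_lt_trans.
  rewrite le_eqVlt; apply/orP; left; apply/eqP; apply: eq_integral => x _ /=.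
  by rewrite ger0_norm//; case/andP: (fM x).
have neg_lty : \int[P]_x g^\- x < +oo.
  rewrite ltey; apply/eqP => ninf; move: cE.
  rewrite -/g integralE ninf /= => /esym.
  by have : 0 <= \int[P]_x g^\+ x by [exact: integral_ge0]; case: (\int[P]_x _) pos_lty.
have intg : P.-integrable setT g.
  apply/integrableP; split => //.
  have -> : \int[P]_x `|g x| = \int[P]_x (g^\+ x + g^\- x).
    by apply: eq_integral => x _; rewrite -[LHS]/((abse \o g) x) fune_abse.
  rewrite ge0_integralD//; [|exact: measurable_funepos|exact: measurable_funeneg].
  exact: lte_add_pinfty.
have IE x : I x = (f x)%:E - g x.
  rewrite /g; case: (I x) (I0 x) => [i| |]//= _.
  by rewrite -!EFinB; congr EFin; ring.
have -> : \int[P]_x I x = \int[P]_x (f x)%:E - c%:E.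
  rewrite cE -integralB//; apply: eq_integral => x _; exact: IE.
have : \int[P]_x (f x)%:E \is a fin_num by exact: integrable_fin_num.
by case: (\int[P]_x _) => //= r _; rewrite -EFinB -EFinD; congr EFin; ring.
Qed.

End integral_of_difference.

Section evolution_decay.
Context (R : realType) (S : ptopologicalType)
  (dO : measure_display) (Omega : measurableType dO)
  (beta : R) (eta : {mfun borel S >-> R})
  (Z : markov_process (Rplus R) (borel S) Omega).
Hypotheses (hS : metrizable_luzin R S) (hZ : right_process Z).
Hypotheses (beta_gt0 : (0 < beta)%R) (eta_gt0 : forall y, (0 < eta y)%R).

(** The two-parameter semigroup E_{r,y}[f(Z_t)] of the spatial motion. *)
Definition transition (r t : R) (f : borel S -> R) (y : borel S) : \bar R :=
  \int[law Z r y]_w (f (Z t w))%:E.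

Section transition_theory.
Variables (f : borel S -> R) (mf : measurable_fun [set: borel S] f).
Hypothesis f0 : forall y, (0 <= f y)%R.

Lemma measurable_observable (s t : R) : (0 <= s <= t)%R ->
  measurable_fun [set: future_space Z s] (fun w => (f (Z t w))%:E).
Proof.
by move=> st; apply/measurable_EFinP; apply: measurableT_comp mf _; exact: measurable_state_future.
Qed.

Lemma measurable_observableT (t : R) : (0 <= t)%R ->
  measurable_fun [set: Omega] (fun w => f (Z t w)).
Proof.
move=> t0; apply: measurableT_comp mf _; apply: (@measurable_future_space _ _ _ _ Z _ _ t).
by apply: measurable_state_future; rewrite t0 lexx.
Qed.

Lemma transition_ge0 r t y : 0 <= transition r t f y.
Proof. by apply: integral_ge0 => w _; rewrite lee_fin. Qed.

Lemma measurable_transition (r t : R) : (0 <= r <= t)%R ->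
  measurable_fun [set: borel S] (transition r t f).
Proof.
move=> /andP[r0 rt]; apply: (measurable_fun_law (@is_interval_Rplus R)).
- exact: RplusP.
- by apply: measurable_observable; rewrite r0.
- by move=> w; rewrite lee_fin.
Qed.

Lemma transition_markov (r s t : R) y : (0 <= r)%R -> (r <= s)%R -> (s <= t)%R ->
  transition r t f y = \int[law Z r y]_w transition s t f (Z s w).
Proof.
move=> r0 rs st; rewrite {1}/transition.
apply: (law_markov_mean (t := s) (@is_interval_Rplus R)) => //.
- exact: RplusP.
- by apply: RplusP; exact: le_trans rs.
- by apply: measurable_observable; rewrite st andbT (le_trans r0).
- by move=> w; rewrite lee_fin.
Qed.

Lemma transition_le (M : R) r t y : (0 <= t)%R -> (forall y, f y <= M)%R ->
  transition r t f y <= M%:E.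
Proof.
move=> t0 fM; rewrite -[leRHS]mule1 -(@probability_setT _ _ _ (law Z r y)) -integral_cst//.
apply: ge0_le_integral => //.
- by move=> w _; rewrite lee_fin.
- by apply/measurable_EFinP; exact: measurable_observableT.
- by move=> w _; rewrite lee_fin.
Qed.

End transition_theory.

Lemma transition_le_fun (f g : borel S -> R) (r t : R) y :
  (0 <= t)%R ->
  measurable_fun [set: borel S] f -> measurable_fun [set: borel S] g ->
  (forall y, 0 <= f y)%R -> (forall y, f y <= g y)%R ->
  transition r t f y <= transition r t g y.
Proof.
move=> t0 mf mg f0 fg; apply: ge0_le_integral => //.
- by move=> w _; rewrite lee_fin.
- by apply/measurable_EFinP; exact: measurable_observableT.
- by apply/measurable_EFinP; exact: measurable_observableT.
- by move=> w _; rewrite lee_fin.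
Qed.

Lemma evolution_sum (F : borel S -> R) (t : R) (u : R -> borel S -> R) (r : R) y :
  Bplus eta F -> evolution_solution beta eta Z F t u -> (0 <= r <= t)%R ->
  transition r t F y =
    (u r y)%:E + \int[law Z r y]_w branching_loss beta eta Z u r t w.
Proof.
move=> [mF F0 [M FM] _] [mu _ uE] /[dup] rt /andP[r0 rt'].
apply: (integral_sub_eq (M := M)) => //.
- by apply: measurable_observableT => //; exact: le_trans rt'.
- by move=> w; rewrite F0 FM.
- apply: (@measurable_future_space _ _ _ _ Z _ _ r).
  exact: (measurable_branching_loss hS hZ beta_gt0 mu).
- by move=> w; exact: branching_loss_ge0.
- exact: uE.
Qed.

Section decay.
Variables (T cT : R) (h : R -> borel S -> \bar R).
Hypotheses (T_gt0 : (0 < T)%R) (cT_gt0 : (0 < cT)%R).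
Hypothesis eta_i : forall (r t : R) (y : borel S),
  (0 <= r)%R -> (r <= t)%R -> (t <= T)%R ->
  (cT^-1 * eta y)%R%:E <= transition r t eta y <= (cT * eta y)%R%:E.

Variables (F : borel S -> R) (k : R) (u : R -> borel S -> R).
Hypotheses (BF : Bplus eta F) (Fk : forall y, (F y <= k * eta y)%R).
Hypotheses (k_ge0 : (0 <= k)%R) (uF : evolution_solution beta eta Z F T u).

Let eta_ge0 y : (0 <= eta y)%R. Proof. exact: ltW. Qed.
Let meta : measurable_fun [set: borel S] eta. Proof. by []. Qed.

Lemma transition_eta_fin r t y : (0 <= r)%R -> (r <= t)%R -> (t <= T)%R ->
  transition r t eta y \is a fin_num.
Proof.
move=> r0 rt tT; have /andP[_ H] := eta_i y r0 rt tT.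
by rewrite ge0_fin_numE ?transition_ge0//; exact: le_lt_trans H (ltry _).
Qed.

(** The lower bound on the mean of eta at time T gives
    eta(y) <= cT E_{t,y}[eta(Z_T)], to be averaged at y = Z_t. The right-hand
    side is the constant H of [mean_rate_ge], the same for all t. *)
Lemma transition_eta_le r t z : (0 <= r)%R -> (r <= t)%R -> (t <= T)%R ->
  transition r t eta z <= cT%:E * transition r T eta z.
Proof.
move=> r0 rt tT; have t0 := le_trans r0 rt.
rewrite (@transition_markov eta _ _ r t T z)//.
rewrite -ge0_integralZl//; last 3 first.
- apply: (measurableT_comp (f := transition t T eta)).
    by apply: measurable_transition => //; rewrite t0.
  exact: measurable_state_ge0.
- by move=> w _; exact: transition_ge0.
- by rewrite lee_fin ltW.
apply: ge0_le_integral => //.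
- by move=> w _; rewrite lee_fin.
- by apply/measurable_EFinP; exact: measurable_observableT.
- apply: measurable_funeM; apply: (measurableT_comp (f := transition t T eta)).
    by apply: measurable_transition => //; rewrite t0.
  exact: measurable_state_ge0.
- move=> w _; have /andP[H _] := eta_i (Z t w) t0 tT (lexx T).
  have /fineK <- := transition_eta_fin (Z t w) t0 tT (lexx T).
  rewrite -EFinM lee_fin -ler_pdivrMl// -lee_fin fineK//.
  exact: transition_eta_fin.
Qed.

Let mu := let: And3 mu _ _ := uF in mu.
Let Bu := let: And3 _ Bu _ := uF in Bu.

(** The evolution equation at time s, averaged at y = Z_s. *)
Lemma evolution_mean (r s : R) z : (0 <= r)%R -> (r <= s)%R -> (s <= T)%R ->
  transition r T F z =
    transition r s (u s) z + \int[law Z r z]_w branching_loss beta eta Z u s T w.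
Proof.
move=> r0 rs sT; have s0 := le_trans r0 rs.
have [mF F0 _ _] := BF.
have s0T : (0 <= s <= T)%R by rewrite s0.
have [mus us0 _ _] := Bu s0T.
have mL : measurable_fun [set: future_space Z s] (branching_loss beta eta Z u s T).
  exact: (measurable_branching_loss hS hZ beta_gt0 mu).
have L0 w : 0 <= branching_loss beta eta Z u s T w by exact: branching_loss_ge0.
rewrite (@transition_markov F mF F0 r s T)//.
rewrite [X in _ = _ + X](law_markov_mean (t := s) (@is_interval_Rplus R))//; last 2 first.
- exact: RplusP.
- exact: RplusP.
rewrite -ge0_integralD//.
- apply: eq_integral => w _; exact: evolution_sum.
- by move=> w _; rewrite lee_fin.
- by apply/measurable_EFinP; exact: measurable_observableT.
- by move=> w _; exact: integral_ge0.
- apply: (measurableT_comp (f := fun x => \int[law Z s x]_w branching_loss beta eta Z u s T w)).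
    by apply: (measurable_fun_law (@is_interval_Rplus R)) => //; exact: RplusP.
  exact: measurable_state_ge0.
Qed.

(** [young_tangent] at x = u(s, Z_s), y = eta(Z_s) with the constant slope m / H,
    in expectation; E_{r,z}[eta(Z_s)] <= H by [transition_eta_le]. *)
Lemma mean_rate_ge r s z (m : R) : (0 <= r)%R -> (r <= s)%R -> (s <= T)%R ->
  (0 <= m)%R -> m%:E <= transition r s (u s) z ->
  ((beta * (cT * fine (transition r T eta z)) `^ beta)^-1 * m `^ (1 + beta))%:E <=
  \int[law Z r z]_w (branching_rate beta eta u s (Z s w))%:E.
Proof.
set H := (cT * _)%R; move=> r0 rs sT m0 mU; have s0 := le_trans r0 rs.
have rT := le_trans rs sT.
have [mus us0 _ _] : Bplus eta (u s) by apply: Bu; rewrite s0.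
have hfin := transition_eta_fin z r0 rT (lexx T).
have h0 : (0 < fine (transition r T eta z))%R.
  have /andP[h1 _] := eta_i z r0 rT (lexx T).
  rewrite -lte_fin fineK//; apply: lt_le_trans h1.
  by rewrite lte_fin mulr_gt0// invr_gt0.
have H0 : (0 < H)%R by rewrite mulr_gt0.
pose th := (m / H)%R.
have th0 : (0 <= th)%R by rewrite divr_ge0// ltW.
have mZ := measurable_state_ge0 Z s0.
have mrate : measurable_fun [set: borel S] (branching_rate beta eta u s).
  rewrite (_ : branching_rate beta eta u s = fun y =>
    (u s y `^ (1 + beta) * (beta^-1 * eta y `^ (- beta)))%R); last first.
    by apply/funext => y; rewrite /branching_rate invfM powRN.
  apply: measurable_funM; first exact: measurableT_comp (measurable_powR _) mus.
  by apply: measurable_funM => //; exact: measurableT_comp (measurable_powR _) meta.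
have rate0 y : (0 <= branching_rate beta eta u s y)%R by exact: branching_rate_ge0.
have c0 : (0 <= (1 + beta) / beta * th `^ beta)%R.
  by rewrite mulr_ge0 ?powR_ge0// divr_ge0 ?(ltW beta_gt0)// addr_ge0// ltW.
have key : (((1 + beta) / beta * th `^ beta) * m)%:E <=
    \int[law Z r z]_w (branching_rate beta eta u s (Z s w))%:E + (th `^ (1 + beta) * H)%:E.
  apply: (@le_trans _ _ (\int[law Z r z]_w
      ((branching_rate beta eta u s (Z s w))%:E + (th `^ (1 + beta))%:E * (eta (Z s w))%:E))).
    apply: (@le_trans _ _ (((1 + beta) / beta * th `^ beta)%:E * transition r s (u s) z)).
      by rewrite EFinM lee_wpmul2l.
    rewrite /transition -ge0_integralZl//; last 2 first.
    - by apply/measurable_EFinP; exact: measurable_observableT.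
    - by move=> w _; rewrite lee_fin.
    apply: ge0_le_integral => //.
    - by move=> w _; rewrite mule_ge0// lee_fin.
    - by apply: measurable_funeM; apply/measurable_EFinP; exact: measurable_observableT.
    - apply: emeasurable_funD; first by apply/measurable_EFinP; exact: measurable_observableT.
      by apply: measurable_funeM; apply/measurable_EFinP; exact: measurable_observableT.
    - by move=> w _; rewrite -!EFinM -EFinD lee_fin young_tangent.
  rewrite ge0_integralD//; last 4 first.
  - by move=> w _; rewrite lee_fin.
  - by apply/measurable_EFinP; exact: measurable_observableT.
  - by move=> w _; rewrite -EFinM lee_fin mulr_ge0// powR_ge0.
  - by apply: measurable_funeM; apply/measurable_EFinP; exact: measurable_observableT.
  rewrite leeD2l// ge0_integralZl//; last 3 first.
  - by apply/measurable_EFinP; exact: measurable_observableT.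
  - by move=> w _; rewrite lee_fin.
  - by rewrite lee_fin powR_ge0.
  rewrite EFinM lee_wpmul2l ?lee_fin ?powR_ge0//.
  apply: (le_trans (transition_eta_le z r0 rs sT)).
  by rewrite /H EFinM fineK.
have -> : ((beta * H `^ beta)^-1 * m `^ (1 + beta))%R =
    ((1 + beta) / beta * th `^ beta * m - th `^ (1 + beta) * H)%R.
  have p1 x : (0 <= x)%R -> (x `^ (1 + beta) = x * x `^ beta)%R.
    move=> x0; rewrite powRD ?powRr1//.
    by rewrite gt_eqF ?addr_gt0.
  rewrite !p1// /th powRM ?invr_ge0 ?(ltW H0)//.
  have Hb : (H `^ beta != 0)%R by rewrite gt_eqF// powR_gt0.
  rewrite -(powR_inv1 (ltW H0)) -powRrM mulN1r powRN powR_inv1 ?(ltW H0)//.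
  by field; rewrite Hb !gt_eqF.
by rewrite EFinB leeBlDr.
Qed.

(** U(s) = E_{r,z}[u(s, Z_s)] solves U' >= U^(1+beta) / (beta H^beta) in
    integrated form, with U(r) = u(r, z) and U(T) <= k h(r,z). *)
Lemma evolution_decay r z : (0 <= r < T)%R ->
  (u r z)%:E <= transition r T eta z *
    (k / (1 + cT `^ (- beta) * (T - r) * k `^ beta) `^ beta^-1)%R%:E.
Proof.
move=> /andP[r0 rT]; have rT' := ltW rT.
have [mF F0 [M FM] _] := BF.
have hfin := transition_eta_fin z r0 rT' (lexx T).
set h0 := fine (transition r T eta z).
have hE : transition r T eta z = h0%:E by rewrite /h0 fineK.
have h_gt0 : (0 < h0)%R.
  have /andP[h1 _] := eta_i z r0 rT' (lexx T).
  rewrite -lte_fin -hE; apply: lt_le_trans h1.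
  by rewrite lte_fin mulr_gt0// invr_gt0.
rewrite hE -EFinM lee_fin.
have Bus s : (r <= s)%R -> (s <= T)%R -> Bplus eta (u s).
  by move=> rs sT; apply: Bu; rewrite sT (le_trans r0 rs).
have [u0|u_le0] := ltP 0%R (u r z); last first.
  apply: (le_trans u_le0); rewrite mulr_ge0 ?(ltW h_gt0)// divr_ge0// powR_ge0//.
have Ffin : transition r T F z \is a fin_num.
  rewrite ge0_fin_numE ?transition_ge0//.
  by apply: le_lt_trans (ltry M); apply: transition_le => //; exact: ltW.
pose U s := fine (transition r s (u s) z).
have U_ge0 s : (r <= s)%R -> (s <= T)%R -> 0 <= transition r s (u s) z.
  by move=> rs sT; have [_ ? _ _] := Bus s rs sT; exact: transition_ge0.
have L_ge0 s : 0 <= \int[law Z r z]_w branching_loss beta eta Z u s T w.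
  by apply: integral_ge0 => w _; exact: branching_loss_ge0.
have UE s : (r <= s)%R -> (s <= T)%R -> transition r s (u s) z = (U s)%:E.
  move=> rs sT; rewrite /U fineK// ge0_fin_numE ?U_ge0//.
  apply: le_lt_trans (_ : transition r T F z < +oo); last by rewrite -ge0_fin_numE// transition_ge0.
  by rewrite (evolution_mean z r0 rs sT) leeDl.
have Ur : U r = u r z.
  have [mur ur0 _ _] := Bus r (lexx r) rT'.
  apply: EFin_inj; rewrite -UE// /transition.
  apply: (@law_initial_int R _ _ _ _ _ Z (@is_interval_Rplus R) r z (fun y => (u r y)%:E)).
  - exact: RplusP.
  - exact/measurable_EFinP.
  - by move=> y; rewrite lee_fin.
have UTh : (U T <= h0 * k)%R.
  rewrite -lee_fin -UE// mulrC EFinM -hE.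
  apply: (@le_trans _ _ (transition r T F z)).
    by rewrite (evolution_mean z r0 rT' (lexx T)) leeDl.
  rewrite /transition -ge0_integralZl//; last 2 first.
  - by apply/measurable_EFinP; apply: measurable_observableT => //; exact: ltW.
  - by move=> w _; rewrite lee_fin.
  apply: ge0_le_integral => //.
  - by move=> w _; rewrite lee_fin.
  - by apply/measurable_EFinP; apply: measurable_observableT => //; exact: ltW.
  - by apply: measurable_funeM; apply/measurable_EFinP; apply: measurable_observableT => //; exact: ltW.
  - by move=> w _; rewrite -EFinM lee_fin.
have increment a c : (r <= a)%R -> (a <= c)%R -> (c <= T)%R ->
    (U a)%:E + \int[law Z r z]_w branching_loss beta eta Z u a c w = (U c)%:E.
  move=> ra ac cT'; have a0 := le_trans r0 ra; have c0 := le_trans a0 ac.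
  have aT := le_trans ac cT'; have rc := le_trans ra ac.
  have Ea := evolution_mean z r0 ra aT; have Ec := evolution_mean z r0 rc cT'.
  have mL x y : (0 <= x)%R -> (y <= T)%R ->
      measurable_fun [set: Omega] (branching_loss beta eta Z u x y).
    move=> x0 yT; apply: (@measurable_future_space _ _ _ _ Z _ _ x).
    exact: (measurable_branching_loss hS hZ beta_gt0 mu).
  have E : \int[law Z r z]_w branching_loss beta eta Z u a T w =
      \int[law Z r z]_w branching_loss beta eta Z u a c w +
      \int[law Z r z]_w branching_loss beta eta Z u c T w.
    rewrite -ge0_integralD//; [|by move=> w _; exact: branching_loss_ge0|exact: mL|
       by move=> w _; exact: branching_loss_ge0|exact: mL].
    apply: eq_integral => w _.
    by rewrite (branching_loss_split hS hZ beta_gt0 mu a c T)// ac.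
  have Lfin : \int[law Z r z]_w branching_loss beta eta Z u c T w \is a fin_num.
    rewrite ge0_fin_numE//.
    apply: le_lt_trans (_ : transition r T F z < +oo); last by rewrite -ge0_fin_numE// transition_ge0.
    by rewrite Ec leeDr// U_ge0.
  have cancel (tot x y i la l : \bar R) : l \is a fin_num ->
      tot = x + la -> tot = y + l -> la = i + l -> x + i = y.
    by move=> lfin -> /[swap] -> /(congr1 (fun x => x - l)); rewrite addeA !addeK.
  rewrite (UE a ra aT) in Ea; rewrite (UE c rc cT') in Ec.
  exact: cancel Lfin Ea Ec E.
have Und a c : (r <= a)%R -> (a <= c)%R -> (c <= T)%R -> (U a <= U c)%R.
  move=> ra ac cT'; rewrite -lee_fin -(increment a c)// leeDl//.
  by apply: integral_ge0 => w _; exact: branching_loss_ge0.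
pose H := (cT * h0)%R.
have H0 : (0 < H)%R by rewrite mulr_gt0.
pose kap := ((beta * H `^ beta)^-1)%R.
have kap0 : (0 < kap)%R by rewrite invr_gt0 mulr_gt0// powR_gt0.
have step a c : (r <= a)%R -> (a <= c)%R -> (c <= T)%R ->
    (U a + (c - a) * kap * U a `^ (1 + beta) <= U c)%R.
  move=> ra ac cT'; rewrite -lee_fin -(increment a c)// EFinD leeD2l//.
  have a0 := le_trans r0 ra.
  rewrite (branching_loss_tonelli hS hZ beta_gt0 mu)//.
  have Ua0 : (0 <= U a)%R by rewrite -lee_fin -UE ?U_ge0// (le_trans ac).
  apply: (@le_trans _ _ (\int[@lebesgue_measure R]_(s in `[a, c])
      (cst (kap * U a `^ (1 + beta))%:E s))).
    rewrite integral_cst//=.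
    rewrite lebesgue_measure_itv/= lte_fin; case: ltP => ac'.
      by rewrite -EFinB -EFinM lee_fin [leRHS]mulrC mulrA.
    have <- : a = c by apply/eqP; rewrite eq_le ac ac'.
    by rewrite subrr !mul0r mule0.
  apply: ge0_le_integral => //.
  - by move=> s _; rewrite lee_fin mulr_ge0 ?powR_ge0// ltW.
  - exact: (measurable_mean_rate hS hZ beta_gt0 mu).
  - move=> s /=; rewrite in_itv/= => /andP[as_ sc].
    have rs := le_trans ra as_; have sT := le_trans sc cT'.
    apply: mean_rate_ge => //.
    by rewrite (UE s)// lee_fin; exact: Und.
have Ur0 : (0 < U r)%R by rewrite Ur.
have UT0 : (0 < U T)%R by apply: lt_le_trans Ur0 (Und _ _ _ _ _).
have k0 : (0 < k)%R.
  by have := lt_le_trans UT0 UTh; rewrite pmulr_rgt0.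
rewrite -Ur; apply: (@powRN_inv_bound _ beta cT (T - r) k h0 (U r) (U T)) => //.
  by rewrite subr_ge0.
exact: (@powRN_euler _ beta kap r T U).
Qed.

End decay.
End evolution_decay.

(** * The Laplace functional of the superprocess *)

Section expeR_regularity.
Context {R : realType}.

Lemma measurable_expeR : measurable_fun [set: \bar R] (@expeR R).
Proof.
apply: (measurability _ (ErealGenOInfty.measurableE R)) => // _ [_ [x ->] <-].
rewrite setTI; have [x0|x0] := ltP x 0%R.
  rewrite (_ : _ @^-1` _ = setT); first exact: measurableT.
  apply/seteqP; split => // y _ /=; rewrite in_itv/= andbT.
  by apply: lt_le_trans (expeR_ge0 y); rewrite lte_fin.
have [y yx] := @expeR_total R x%:E x0.
rewrite (_ : _ @^-1` _ = `]y, +oo[%classic); first exact: emeasurable_itv.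
by apply/seteqP; split => z /=; rewrite !in_itv/= !andbT -yx lte_expeR.
Qed.

Lemma expeR_le1 (x : \bar R) : x <= 0 -> expeR x <= 1.
Proof. by move=> x0; rewrite -expeR0 lee_expeR. Qed.

Lemma cvg_expeRN (J_ : (\bar R)^nat) (J : \bar R) : 0 <= J ->
  J_ n @[n --> \oo] --> J -> expeR (- J_ n) @[n --> \oo] --> expeR (- J).
Proof.
move=> J0 cJ.
have {}cJ : - J_ n @[n --> \oo] --> - J by exact: cvgeN.
apply: (@cvg_comp _ _ _ (fun n => - J_ n) expeR _ _ _ cJ).
case: J J0 cJ => [r| |]//= _ _.
  move=> P nP; apply/nbhs_EFin => /=.
  have {}nP := (nbhs_EFin _ _).1 nP.
  exact: (@continuous_expR R (- r)%R _ nP).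
move=> P nP; have /nbhs_ballP[e /= e0 eP] := (nbhs_EFin _ _).1 nP.
exists (ln e); split; first exact: num_real.
move=> [x| |]//= xe; last by apply: (eP 0%R); exact: ballxx.
apply: (eP (expR x)); rewrite /ball/= sub0r normrN ger0_norm ?expR_ge0//.
by rewrite -[ltRHS](@lnK _ e)// ltr_expR -lte_fin.
Qed.
Lemma measurable_expeRN d (Y : measurableType d) (g : Y -> \bar R) :
  measurable_fun setT g -> measurable_fun setT (fun w => expeR (- g w)).
Proof.
move=> mg; apply: (measurableT_comp (f := expeR)); first exact: measurable_expeR.
exact: measurableT_comp.
Qed.

Lemma expeRND (x y : \bar R) : 0 <= x -> 0 <= y ->
  expeR (- (x + y)) = expeR (- x) * expeR (- y).
Proof. by move=> x0 y0; rewrite -expeRD -oppeD// ge0_adde_def// inE. Qed.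

End expeR_regularity.

Section pairing_theory.
Context (R : realType) (S : ptopologicalType) (eta : {mfun borel S >-> R}).
Implicit Types (f g : borel S -> R) (nu : eta_measures eta).

Lemma measurable_evaluation (B : set (borel S)) : measurable B ->
  measurable_fun [set: eta_measures eta] (fun nu => nu B).
Proof.
move=> mB _ U mU; rewrite setTI; apply: sub_sigma_algebra.
by exists B, U.
Qed.

Lemma pairing_ge0 f nu : (forall y, 0 <= f y)%R -> 0 <= pairing f nu.
Proof. by move=> f0; apply: integral_ge0 => y _; rewrite lee_fin. Qed.

Lemma measurable_pairing f : measurable_fun [set: borel S] f ->
  (forall y, 0 <= f y)%R ->
  measurable_fun [set: eta_measures eta] (pairing f).
Proof.
move=> mf f0; apply: (@measurable_fun_integral_kernel _ _ _ _ _
  (fun nu : eta_measures eta => eta_measure_val nu) _ (fun y => (f y)%:E)).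
- exact: measurable_evaluation.
- by move=> y; rewrite lee_fin.
- exact/measurable_EFinP.
Qed.

Lemma pairing_dirac f y : measurable_fun [set: borel S] f ->
  pairing f (eta_dirac eta y) = (f y)%:E.
Proof.
move=> mf; rewrite /pairing /eta_dirac/= integral_dirac//; last exact/measurable_EFinP.
by rewrite diracT mul1e.
Qed.

Lemma pairingD f g nu : measurable_fun [set: borel S] f ->
  measurable_fun [set: borel S] g ->
  (forall y, 0 <= f y)%R -> (forall y, 0 <= g y)%R ->
  pairing (fun y => f y + g y)%R nu = pairing f nu + pairing g nu.
Proof.
move=> mf mg f0 g0; rewrite /pairing -ge0_integralD//.
- by move=> y _; rewrite lee_fin.
- exact/measurable_EFinP.
- by move=> y _; rewrite lee_fin.
- exact/measurable_EFinP.
Qed.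

Lemma le_pairing f g nu : measurable_fun [set: borel S] f ->
  measurable_fun [set: borel S] g ->
  (forall y, 0 <= f y)%R -> (forall y, f y <= g y)%R ->
  pairing f nu <= pairing g nu.
Proof.
move=> mf mg f0 fg; apply: ge0_le_integral => //.
- by move=> y _; rewrite lee_fin.
- exact/measurable_EFinP.
- exact/measurable_EFinP.
- by move=> y _; rewrite lee_fin.
Qed.

Lemma pairing_null f (nu : eta_measures eta) : measurable_fun [set: borel S] f ->
  nu setT = 0 -> pairing f nu = 0.
Proof. by move=> mf nu0; apply: null_set_integral => //; exact/measurable_EFinP. Qed.

Lemma BplusD f g : Bplus eta f -> Bplus eta g -> Bplus eta (fun y => f y + g y)%R.
Proof.
move=> [mf f0 [Mf fM] [cf fc]] [mg g0 [Mg gM] [cg gc]]; split.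
- exact: measurable_funD.
- by move=> y; rewrite addr_ge0.
- by exists (Mf + Mg)%R => y; rewrite lerD.
- by exists (cf + cg)%R => y; rewrite mulrDl lerD.
Qed.

Lemma Bplus0 : Bplus eta (fun=> 0%R).
Proof.
split => //; first by exists 0%R.
by exists 0%R => y; rewrite mul0r.
Qed.

End pairing_theory.

Section superprocess_laplace.
Context (R : realType) (S : ptopologicalType)
  (dO : measure_display) (Omega : measurableType dO)
  (dX : measure_display) (OmegaX : measurableType dX)
  (T beta : R) (eta : {mfun borel S >-> R})
  (Z : markov_process (Rplus R) (borel S) Omega)
  (X : markov_process `[0%R, T] (eta_measures eta) OmegaX).
Hypotheses (hS : metrizable_luzin R S) (hZ : right_process Z).
Hypotheses (beta_gt0 : (0 < beta)%R) (eta_gt0 : forall y, (0 < eta y)%R).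
Hypothesis hX : is_superprocess beta Z X.
Implicit Types (F G : borel S -> R) (r t : R) (u v : R -> borel S -> R).
Variable cT : R.
Hypothesis cT_gt0 : (0 < cT)%R.
Hypothesis eta_i : forall (r t : R) (y : borel S),
  (0 <= r)%R -> (r <= t)%R -> (t <= T)%R ->
  (cT^-1 * eta y)%R%:E <= transition Z r t eta y <= (cT * eta y)%R%:E.

(** The Laplace formula compares two such functions ([log_laplace_le]), and the
    evolution equation then estimates their difference. *)
Definition log_laplace (F : borel S -> R) (t : R) (u : R -> borel S -> R) :=
  evolution_solution beta eta Z F t u /\
  forall (r : R) (mu : eta_measures eta), (0 <= r <= t)%R ->
    \int[law X r mu]_w expeR (- pairing F (X t w)) = expeR (- pairing (u r) mu).

Lemma log_laplace_exists F t : Bplus eta F -> (0 <= t <= T)%R ->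
  exists u, log_laplace F t u.
Proof.
by move=> BF tT; have [u [uF _ uL]] := hX.1 F t BF tT; exists u.
Qed.

Let DX : set R := `[0%R, T]%classic.
Let DXI : is_interval DX. Proof. exact: interval_is_interval. Qed.
Let DXP (t : R) : (0 <= t <= T)%R -> DX t.
Proof. by move=> tT; rewrite /DX/= in_itv. Qed.

Let futureX (t : R) := obs_space X (DX `&` `[t, +oo[).

Lemma measurable_pairing_state (I : set R) (t : R) (f : borel S -> R) :
  is_interval I -> I `<=` DX -> I t -> Bplus eta f ->
  measurable_fun [set: obs_space X I] (fun w => pairing f (X t w)).
Proof.
move=> iI ID It [mf f0 _ _]; apply: (measurableT_comp (f := pairing f)).
  exact: measurable_pairing.
exact: measurable_state.
Qed.

Lemma measurable_pairingT (t : R) (f : borel S -> R) : (0 <= t <= T)%R ->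
  measurable_fun [set: borel S] f -> (forall y, 0 <= f y)%R ->
  measurable_fun [set: OmegaX] (fun w => pairing f (X t w)).
Proof.
move=> tT mf f0; apply: (measurableT_comp (f := pairing f)).
  exact: measurable_pairing.
by apply: measurable_stateT => //; exact: DXP.
Qed.

Lemma log_laplace_Bplus F t u r : log_laplace F t u -> (0 <= r <= t)%R ->
  Bplus eta (u r).
Proof. by move=> [[_ + _] _]; apply. Qed.

Lemma log_laplace_dirac F t u r y : log_laplace F t u -> (0 <= r <= t)%R ->
  \int[law X r (eta_dirac eta y)]_w expeR (- pairing F (X t w)) = expeR (- (u r y)%:E).
Proof.
move=> Lu rt; rewrite Lu.2// pairing_dirac//.
by have [] := log_laplace_Bplus Lu rt.
Qed.

Lemma log_laplace_le F G t u v r y : Bplus eta F -> Bplus eta G ->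
  (forall y, F y <= G y)%R -> (t <= T)%R ->
  log_laplace F t u -> log_laplace G t v -> (0 <= r <= t)%R -> (u r y <= v r y)%R.
Proof.
move=> [mF F0 _ _] [mG G0 _ _] FG tT Lu Lv /[dup] rt /andP[r0 rt'].
have t0T : (0 <= t <= T)%R by rewrite tT (le_trans r0).
rewrite -lee_fin -leeN2 -lee_expeR -(log_laplace_dirac y Lv rt) -(log_laplace_dirac y Lu rt).
apply: ge0_le_integral => //.
- by move=> w _; exact: expeR_ge0.
- by apply: measurable_expeRN; exact: measurable_pairingT.
- by apply: measurable_expeRN; exact: measurable_pairingT.
- by move=> w _; rewrite lee_expeR leeN2; exact: le_pairing.
Qed.

(** u >= v by [log_laplace_le]; the branching term subtracted for F + G is
    therefore at least the one subtracted for G. *)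
Lemma log_laplace_subadditive F G t u v r y : Bplus eta F -> Bplus eta G ->
  (t <= T)%R ->
  log_laplace (fun y => F y + G y)%R t u -> log_laplace G t v -> (0 <= r <= t)%R ->
  (u r y)%:E <= transition Z r t F y + (v r y)%:E.
Proof.
move=> BF BG tT Lu Lv /[dup] rt /andP[r0 rt'].
have BFG := BplusD BF BG.
have [mF F0 [MF FM] _] := BF; have [mG G0 [MG GM] _] := BG.
have t0 := le_trans r0 rt'.
have vu q x : (0 <= q <= t)%R -> (v q x <= u q x)%R.
  by move=> qt; apply: (log_laplace_le _ BG BFG) Lv Lu qt => // y'; rewrite lerDr.
have EG := evolution_sum hS hZ beta_gt0 y BG Lv.1 rt.
have EFG := evolution_sum hS hZ beta_gt0 y BFG Lu.1 rt.
have TD : transition Z r t (fun y => F y + G y)%R y = transition Z r t F y + transition Z r t G y.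
  rewrite /transition -ge0_integralD//.
  - by move=> w _; rewrite lee_fin.
  - by apply/measurable_EFinP; exact: measurable_observableT.
  - by move=> w _; rewrite lee_fin.
  - by apply/measurable_EFinP; exact: measurable_observableT.
rewrite TD in EFG.
have Lvu : \int[law Z r y]_w branching_loss beta eta Z v r t w <=
    \int[law Z r y]_w branching_loss beta eta Z u r t w.
  have [[mv Bv _] _] := Lv; have [[mu Bu _] _] := Lu.
  apply: ge0_le_integral => //.
  - by move=> w _; exact: branching_loss_ge0.
  - apply: (@measurable_future_space _ _ _ _ Z _ _ r).
    exact: (measurable_branching_loss hS hZ beta_gt0 mv).
  - apply: (@measurable_future_space _ _ _ _ Z _ _ r).
    exact: (measurable_branching_loss hS hZ beta_gt0 mu).
  - move=> w _; apply: ge0_le_integral => //.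
    + by move=> s _; rewrite lee_fin branching_rate_ge0.
    + exact: (measurable_rate_time hS hZ mv).
    + exact: (measurable_rate_time hS hZ mu).
    + move=> s /=; rewrite in_itv/= => /andP[rs st].
      have st0 : (0 <= s <= t)%R by rewrite st (le_trans r0).
      have [_ v0 _ _] := Bv s st0; have [_ u0 _ _] := Bu s st0.
      rewrite lee_fin /branching_rate ler_wpM2r//.
        by rewrite invr_ge0 mulr_ge0 ?powR_ge0// ltW.
      apply: ge0_ler_powR; rewrite ?nnegrE//; last exact: vu.
      by rewrite addr_ge0// ltW.
have finF : transition Z r t F y \is a fin_num.
  rewrite ge0_fin_numE ?transition_ge0//.
  by apply: le_lt_trans (ltry MF); exact: transition_le.
have finG : transition Z r t G y \is a fin_num.
  rewrite ge0_fin_numE ?transition_ge0//.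
  by apply: le_lt_trans (ltry MG); exact: transition_le.
have L0 : 0 <= \int[law Z r y]_w branching_loss beta eta Z v r t w.
  by apply: integral_ge0 => w _; exact: branching_loss_ge0.
move: EG EFG Lvu L0 finF finG.
case: (transition Z r t F y) => [f| |]//; case: (transition Z r t G y) => [g| |]//.
case: (\int[law Z r y]_w branching_loss beta eta Z u r t w) => [lu| |]//;
  case: (\int[law Z r y]_w branching_loss beta eta Z v r t w) => [lv| |]//.
rewrite -!EFinD !lee_fin => -[->] [] E ? _ _ _; lra.
Qed.

Lemma law_markovX (r t : R) mu (H G : OmegaX -> \bar R) :
  (0 <= r)%R -> (r <= t)%R -> (t <= T)%R ->
  measurable_fun [set: obs_space X `[r, t]] H -> (forall w, 0 <= H w) ->
  measurable_fun [set: futureX t] G -> (forall w, 0 <= G w) ->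
  \int[law X r mu]_w (H w * G w) =
  \int[law X r mu]_w (H w * \int[law X t (X t w)]_w' G w').
Proof.
move=> r0 rt tT; apply: law_markov_fun => //.
  by apply: DXP; rewrite r0 (le_trans rt).
by apply: DXP; rewrite tT (le_trans r0).
Qed.

(** The Markov property of X at time t, started from the unit mass at y. *)
Lemma log_laplace_flow F (w : R -> borel S -> R) t v r y : Bplus eta F -> log_laplace F T w ->
  (0 <= r <= t)%R -> (t <= T)%R -> log_laplace (w t) t v -> v r y = w r y.
Proof.
move=> BF Lw /[dup] rt /andP[r0 rt'] tT Lv.
have [mF F0 _ _] := BF.
have rT : (0 <= r <= T)%R by rewrite r0 (le_trans rt').
have T0 : (0 <= T)%R by rewrite (le_trans r0)// (le_trans rt').
have t0T : (0 <= t <= T)%R by rewrite tT (le_trans r0).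
suff : expeR (- (v r y)%:E) = expeR (- (w r y)%:E).
  by move=> /expeR_inj/eqP; rewrite eqe_opp => /eqP[].
rewrite -(log_laplace_dirac y Lv rt) -(log_laplace_dirac y Lw rT).
rewrite (@law_markov_mean R DX _ _ _ _ X DXI r t (eta_dirac eta y)
  (fun w => expeR (- pairing F (X T w))))//.
- by apply: eq_integral => w' _; rewrite Lw.2.
- apply: measurable_expeRN; apply: measurable_pairing_state => //.
  + exact: is_interval_future.
  + by split; [apply: DXP; rewrite T0 lexx|rewrite /= in_itv/= tT].
- by move=> w'; exact: expeR_ge0.
Qed.

Lemma transition_fineK F r t y : Bplus eta F -> (0 <= t)%R ->
  transition Z r t F y = (fine (transition Z r t F y))%:E.
Proof.
move=> [mF F0 [M FM] _] t0; rewrite fineK// ge0_fin_numE ?transition_ge0//.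
by apply: le_lt_trans (ltry M); exact: transition_le.
Qed.

Lemma Bplus_transition F r t : Bplus eta F -> (0 <= r)%R -> (r <= t)%R -> (t <= T)%R ->
  Bplus eta (fun y => fine (transition Z r t F y)).
Proof.
move=> BF r0 rt tT; have t0 := le_trans r0 rt.
have [mF F0 [M FM] [c Fc]] := BF; split.
- apply: (measurableT_comp (f := fine)) => //.
  by apply: measurable_transition => //; rewrite r0.
- by move=> y; rewrite fine_ge0// transition_ge0.
- by exists M => y; rewrite -lee_fin -transition_fineK//; exact: transition_le.
- have eta0 y : (0 <= eta y)%R by exact: ltW.
  exists (`|c| * cT)%R => y; rewrite -lee_fin -transition_fineK//.
  apply: (@le_trans _ _ (`|c|%:E * transition Z r t eta y)).
    rewrite /transition -ge0_integralZl//; last 2 first.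
    + by apply/measurable_EFinP; exact: measurable_observableT.
    + by move=> w _; rewrite lee_fin.
    apply: ge0_le_integral => //.
    + by move=> w _; rewrite lee_fin.
    + by apply/measurable_EFinP; exact: measurable_observableT.
    + by apply: measurable_funeM; apply/measurable_EFinP; exact: measurable_observableT.
    + by move=> w _; rewrite -EFinM lee_fin (le_trans (Fc _))// ler_wpM2r// ler_norm.
  rewrite -mulrA EFinM lee_wpmul2l ?lee_fin//.
  by case/andP: (eta_i y r0 rt tT).
Qed.

Definition atoms := seq (R * (borel S -> R)).

(** Atoms in chronological order, starting at time [r]: the recursion on the
    list is the order in which the Markov property removes them. *)
Fixpoint admissible (r : R) (L : atoms) : Prop :=
  if L is p :: L' then
    [/\ (r <= p.1)%R, (p.1 <= T)%R, Bplus eta p.2 & admissible p.1 L']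
  else True.

Definition atom_mean (L : atoms) (r : R) (y : borel S) : R :=
  (\sum_(p <- L) fine (transition Z r p.1 p.2 y))%R.

Definition atom_pairing (L : atoms) (w : OmegaX) : \bar R :=
  \sum_(p <- L) pairing p.2 (X p.1 w).

Lemma admissible_le r s L : (r <= s)%R -> admissible s L -> admissible r L.
Proof. by case: L => // p L rs [? ? ? ?]; split => //; exact: le_trans rs _. Qed.

Lemma Bplus_atom_mean L r : (0 <= r)%R -> admissible r L -> Bplus eta (atom_mean L r).
Proof.
move=> r0; elim: L => [_|p L IH [rp pT Bp aL]].
  rewrite (_ : atom_mean _ _ = fun=> 0%R); first exact: Bplus0.
  by apply/funext => y; rewrite /atom_mean big_nil.
rewrite (_ : atom_mean _ _ = fun y => fine (transition Z r p.1 p.2 y) + atom_mean L r y)%R.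
  by apply: BplusD; [exact: Bplus_transition|apply: IH; exact: admissible_le aL].
by apply/funext => y; rewrite /atom_mean big_cons.
Qed.

Lemma transitionD F G r t y : (0 <= t)%R -> Bplus eta F -> Bplus eta G ->
  transition Z r t (fun y => F y + G y)%R y = transition Z r t F y + transition Z r t G y.
Proof.
move=> t0 [mF F0 _ _] [mG G0 _ _]; rewrite /transition -ge0_integralD//.
- by move=> w _; rewrite lee_fin.
- by apply/measurable_EFinP; exact: measurable_observableT.
- by move=> w _; rewrite lee_fin.
- by apply/measurable_EFinP; exact: measurable_observableT.
Qed.

Lemma atom_mean_markov L r t y : (0 <= r)%R -> (r <= t)%R -> admissible t L ->
  transition Z r t (atom_mean L t) y = (atom_mean L r y)%:E.
Proof.
move=> r0 rt; have t0 := le_trans r0 rt.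
elim: L => [_|p L IH [rp pT Bp aL]].
  rewrite (_ : atom_mean _ _ = fun=> 0%R).
    by rewrite /transition integral0 /atom_mean big_nil.
  by apply/funext => x; rewrite /atom_mean big_nil.
rewrite (_ : atom_mean (p :: L) t = fun y => fine (transition Z t p.1 p.2 y) + atom_mean L t y)%R.
  have aL' := admissible_le rp aL.
  rewrite transitionD//; [|exact: Bplus_transition|exact: Bplus_atom_mean].
  rewrite IH// /atom_mean big_cons EFinD; congr (_ + _).
  have [mp p0 _ _] := Bp.
  rewrite -transition_fineK//; last by rewrite (le_trans t0).
  rewrite (@transition_markov _ _ _ _ Z p.2 mp p0 r t p.1)//.
  apply: eq_integral => w _; rewrite -transition_fineK//.
  by rewrite (le_trans t0).
by apply/funext => x; rewrite /atom_mean big_cons.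
Qed.

Lemma atom_pairing_ge0 L r w : admissible r L -> 0 <= atom_pairing L w.
Proof.
elim: L r => [|p L IH] r; first by rewrite /atom_pairing big_nil.
move=> [_ _ [_ p0 _ _] aL]; rewrite /atom_pairing big_cons adde_ge0//.
  exact: pairing_ge0.
exact: IH aL.
Qed.

Lemma measurable_atom_pairing L t : (0 <= t)%R -> admissible t L ->
  measurable_fun [set: futureX t] (atom_pairing L).
Proof.
move=> t0; elim: L => [_|p L IH [tp pT Bp aL]].
  rewrite (_ : atom_pairing _ = cst 0); first exact: measurable_cst.
  by apply/funext => w; rewrite /atom_pairing big_nil.
rewrite (_ : atom_pairing _ = fun w => pairing p.2 (X p.1 w) + atom_pairing L w); last first.
  by apply/funext => w; rewrite /atom_pairing big_cons.
apply: emeasurable_funD; last by apply: IH; exact: admissible_le aL.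
apply: measurable_pairing_state => //.
- exact: is_interval_future.
- by split; [apply: DXP; rewrite pT (le_trans t0)|rewrite /= in_itv/= tp].
Qed.

(** Conditioning on X_t at the first atom (t, f), the induction hypothesis
    bounds the remaining factor below by exp (- <g, X_t>), where
    g = atom_mean L t + w0 t. Then [log_laplace_subadditive] splits off
    f + atom_mean L t from f + g, and w0 t flows back to w0 r. *)
Lemma atom_laplace_ge F (w0 : R -> borel S -> R) L r mu :
  Bplus eta F -> log_laplace F T w0 -> (0 <= r <= T)%R -> admissible r L ->
  expeR (- pairing (fun y => atom_mean L r y + w0 r y)%R mu) <=
  \int[law X r mu]_w expeR (- (atom_pairing L w + pairing F (X T w))).
Proof.
move=> BF Lw; have [mF F0 _ _] := BF.
elim: L r mu => [|[t f] L IH] r mu /[dup] rT /andP[r0 rT'].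
  move=> _; rewrite (_ : (fun y => _) = w0 r).
    rewrite -Lw.2// le_eqVlt; apply/orP; left; apply/eqP.
    by apply: eq_integral => w _; rewrite /atom_pairing big_nil add0e.
  by apply/funext => y; rewrite /atom_mean big_nil add0r.
move=> [/= rt tT Bf]; rewrite -/(admissible t L) => aL; have [mf f0 _ _] := Bf.
have t0 := le_trans r0 rt.
have t0T : (0 <= t <= T)%R by rewrite t0.
have rt' : (0 <= r <= t)%R by rewrite r0.
have Bw := log_laplace_Bplus Lw t0T; have [mw w00 _ _] := Bw.
have Ba := Bplus_atom_mean t0 aL; have [ma a0 _ _] := Ba.
pose H w := expeR (- pairing f (X t w)).
pose G w := expeR (- (atom_pairing L w + pairing F (X T w))).
have pX : `[r, t]%classic `<=` DX.
  move=> x; rewrite /= in_itv/= => /andP[rx xt].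
  by apply: DXP; rewrite (le_trans r0 rx) (le_trans xt tT).
have H0 w : 0 <= H w by exact: expeR_ge0.
have G0 w : 0 <= G w by exact: expeR_ge0.
have mH : measurable_fun [set: obs_space X `[r, t]] H.
  apply: measurable_expeRN; apply: measurable_pairing_state => //.
  - exact: interval_is_interval.
  - by rewrite /= in_itv/= rt lexx.
have mG : measurable_fun [set: futureX t] G.
  apply: measurable_expeRN; apply: emeasurable_funD; first exact: measurable_atom_pairing.
  apply: measurable_pairing_state => //.
  - exact: is_interval_future.
  - by split; [apply: DXP; rewrite lexx (le_trans t0)|rewrite /= in_itv/= tT].
have -> : \int[law X r mu]_w expeR (- (atom_pairing ((t, f) :: L) w + pairing F (X T w))) =
    \int[law X r mu]_w (H w * G w).
  apply: eq_integral => w _; rewrite /atom_pairing big_cons -addeA expeRND//.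
    exact: pairing_ge0.
  by rewrite adde_ge0 ?pairing_ge0//; exact: atom_pairing_ge0 aL.
rewrite (law_markovX _ r0 rt tT mH H0 mG G0).
pose g y := (atom_mean L t y + w0 t y)%R.
have Bg : Bplus eta g by exact: BplusD.
have Bfg : Bplus eta (fun y => f y + g y)%R by exact: BplusD.
have [mfg fg0 _ _] := Bfg; have [mg g0 _ _] := Bg.
have [u Lu] := log_laplace_exists Bfg t0T.
have [v Lv] := log_laplace_exists Bw t0T.
apply: (@le_trans _ _ (\int[law X r mu]_w expeR (- pairing (fun y => f y + g y)%R (X t w)))); last first.
  have mHT : measurable_fun [set: OmegaX] H.
    apply: measurable_fun_obs_space mH => //; exact: interval_is_interval.
  apply: ge0_le_integral => //.
  - by move=> w _; exact: expeR_ge0.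
  - by apply: measurable_expeRN; exact: measurable_pairingT.
  - apply: emeasurable_funM => //.
    apply: (measurableT_comp (f := fun x => \int[law X t x]_w' G w')).
      by apply: measurable_fun_law => //; exact: DXP.
    by apply: measurable_stateT => //; exact: DXP.
  - move=> w _; rewrite pairingD// expeRND ?pairing_ge0//.
    by apply: lee_wpmul2l; [exact: expeR_ge0|exact: IH].
rewrite Lu.2// lee_expeR leeN2.
have Bu := log_laplace_Bplus Lu rt'; have [mu_ u0 _ _] := Bu.
have aTL : admissible r ((t, f) :: L) by split.
have [mM M0 _ _] := Bplus_atom_mean r0 aTL.
have [mwr wr0 _ _] := log_laplace_Bplus Lw rT.
apply: le_pairing => //; first exact: measurable_funD.
move=> y; rewrite -lee_fin.
have assoc : (fun y => f y + g y)%R = (fun y => (f y + atom_mean L t y) + w0 t y)%R.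
  by apply/funext => x; rewrite /g addrA.
rewrite assoc in Lu.
apply: (le_trans (log_laplace_subadditive y (BplusD Bf Ba) Bw tT Lu Lv rt')).
rewrite (log_laplace_flow y BF Lw rt' tT Lv) EFinD leeD2r//.
rewrite transitionD// atom_mean_markov// /atom_mean big_cons EFinD leeD2r//.
by rewrite -transition_fineK.
Qed.

End superprocess_laplace.

(** * Limits of Laplace functionals *)

Section limits.
Context {R : realType}.

Lemma ge0_cvg (u : (\bar R)^nat) (l : \bar R) :
  (forall n, 0 <= u n) -> u n @[n --> \oo] --> l -> 0 <= l.
Proof.
move=> u0 ul; have -> : l = limn u by apply/esym/cvg_lim.
by apply: lime_ge; [apply/cvg_ex; exists l|exact: nearW].
Qed.

Lemma laplace_cvg d (T : measurableType d) (P : probability T R)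
    (G_ : (T -> \bar R)^nat) (G : T -> \bar R) :
  (forall n, measurable_fun setT (G_ n)) -> measurable_fun setT G ->
  {ae P, forall w, (forall n, 0 <= G_ n w) /\ G_ n w @[n --> \oo] --> G w} ->
  \int[P]_w expeR (- G_ n w) @[n --> \oo] --> \int[P]_w expeR (- G w).
Proof.
move=> mG_ mG cG.
have [] // := @dominated_convergence _ T R P setT measurableT
  (fun n w => expeR (- G_ n w)) (fun w => expeR (- G w)) (cst 1).
- by move=> n; exact: measurable_expeRN.
- exact: measurable_expeRN.
- apply: filterS cG => w [G0 Gw] _; apply: cvg_expeRN => //; exact: ge0_cvg Gw.
- exact: finite_measure_integrable_cst.
- apply: filterS cG => w [G0 _] n _.
  by rewrite gee0_abs ?expeR_ge0// expeR_le1// oppe_le0.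
Qed.

Lemma cvg_nnesum (I : Type) (s : seq I) (Q : pred I) (F_ : nat -> I -> \bar R)
    (F : I -> \bar R) :
  (forall n i, 0 <= F_ n i) -> (forall i, F_ n i @[n --> \oo] --> F i) ->
  \sum_(i <- s | Q i) F_ n i @[n --> \oo] --> \sum_(i <- s | Q i) F i.
Proof.
move=> F0 cF; elim: s => [|i s IH].
  by rewrite big_nil; under eq_fun do rewrite big_nil; exact: cvg_cst.
rewrite big_cons; under eq_fun do rewrite big_cons.
case: ifP => // _; apply: cvgeD => //.
rewrite ge0_adde_def// inE; first exact: ge0_cvg (cF i).
by apply: (ge0_cvg _ IH) => n; exact: sume_ge0.
Qed.

(** The truncation f /\ n g increases to f because g > 0. It brings f below a
    multiple of g. *)
Lemma cvg_pairing_min (S : ptopologicalType) (eta : {mfun borel S >-> R})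
    (f g : borel S -> R) (nu : eta_measures eta) :
  measurable_fun [set: borel S] f -> measurable_fun [set: borel S] g ->
  (forall y, 0 <= f y)%R -> (forall y, 0 < g y)%R ->
  pairing (fun y => Num.min (f y) (n%:R * g y))%R nu @[n --> \oo] --> pairing f nu.
Proof.
move=> mf mg f0 g0.
pose f_ n y : \bar R := (Num.min (f y) (n%:R * g y))%:E.
have g_n0 y (n : nat) : (0 <= n%:R * g y)%R by rewrite mulr_ge0// ltW.
have cf y : f_ n y @[n --> \oo] --> (f y)%:E.
  apply: cvg_near_cst; near=> n; rewrite /f_ min_l// -ler_pdivrMr//.
  near: n; exact: nbhs_infty_ger.
have := @cvg_monotone_convergence _ _ R nu setT measurableT f_.
have -> : \int[nu]_(y in setT) limn (f_ ^~ y) = pairing f nu.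
  by apply: eq_integral => y _; apply/cvg_lim.
apply.
- move=> n; apply/measurable_EFinP; apply: measurable_minr => //.
  exact: measurable_funM.
- by move=> n y _; rewrite lee_fin le_min f0 g_n0.
- move=> y _ a b ab; rewrite lee_fin le_min ge_min lexx/= ge_min.
  by rewrite ler_wpM2r ?ler_nat// ?orbT// ltW.
Unshelve. all: by end_near. Qed.

Lemma measurable_sum_seq d (Y : measurableType d) (I : eqType) (s : seq I)
    (g : I -> Y -> \bar R) : (forall i, i \in s -> measurable_fun setT (g i)) ->
  measurable_fun setT (fun w => \sum_(i <- s) g i w).
Proof.
elim: s => [_|i s IH mg].
  by under eq_fun do rewrite big_nil; exact: measurable_cst.
under eq_fun do rewrite big_cons; apply: emeasurable_funD.
  by apply: mg; rewrite mem_head.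
by apply: IH => j js; apply: mg; rewrite in_cons js orbT.
Qed.

Lemma ae_forall_ord d (Y : measurableType d) (P : probability Y R) n
    (Q : 'I_n -> Y -> Prop) : (forall i, {ae P, forall w, Q i w}) ->
  {ae P, forall w, forall i, Q i w}.
Proof.
move=> aeQ; have : {ae P, forall w, forall m (mn : (m < n)%N), Q (Ordinal mn) w}.
  apply: ae_foralln => m; have [mn|nm] := pselect (m < n)%N.
    apply: filterS (aeQ (Ordinal mn)) => w Qw mn'.
    by rewrite (bool_irrelevance mn' mn).
  by apply: aeW => w mn; exfalso; exact: nm.
by apply: filterS => w Qw [m mn].
Qed.

End limits.

(** * Lower bounds for J-functionals *)

Section J_lower_bound.
Context (R : realType) (S : ptopologicalType)
  (dO : measure_display) (Omega : measurableType dO)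
  (dX : measure_display) (OmegaX : measurableType dX)
  (T beta : R) (eta : {mfun borel S >-> R})
  (Z : markov_process (Rplus R) (borel S) Omega)
  (X : markov_process `[0%R, T] (eta_measures eta) OmegaX).
Hypotheses (hS : metrizable_luzin R S) (hZ : right_process Z).
Hypotheses (T_gt0 : (0 < T)%R).
Hypotheses (beta_gt0 : (0 < beta)%R) (eta_gt0 : forall y, (0 < eta y)%R).
Hypothesis hX : is_superprocess beta Z X.
Variable cT : R.
Hypothesis cT_gt0 : (0 < cT)%R.
Hypothesis eta_i : forall (r t : R) (y : borel S),
  (0 <= r)%R -> (r <= t)%R -> (t <= T)%R ->
  (cT^-1 * eta y)%R%:E <= transition Z r t eta y <= (cT * eta y)%R%:E.
Variables (k r : R) (z : borel S).
Hypotheses (k_ge0 : (0 <= k)%R) (rT : (0 <= r < T)%R).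

Notation random_measure := (R.-ker Omega ~> measurableTypeR R).

Let r0 : (0 <= r)%R. Proof. by case/andP: rT. Qed.
Let rT' : (r <= T)%R. Proof. by case/andP: rT => _ /ltW. Qed.
Let T0T : (0 <= T <= T)%R. Proof. by rewrite lexx ltW. Qed.
Let r0T : (0 <= r <= T)%R. Proof. by rewrite r0. Qed.
Let eta_ge0 y : (0 <= eta y)%R. Proof. exact: ltW. Qed.
Let meta : measurable_fun [set: borel S] eta. Proof. by []. Qed.

Definition terminal_bound : \bar R := transition Z r T eta z *
  (k / (1 + cT `^ (- beta) * (T - r) * k `^ beta) `^ beta^-1)%R%:E.

Definition mean_functional (A : random_measure) : \bar R :=
  \int[law Z r z]_w A w `[r, T]%classic.

Definition terminal_mass (w : OmegaX) : \bar R := k%:E * pairing eta (X T w).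

Lemma terminal_mass_ge0 w : 0 <= terminal_mass w.
Proof. by rewrite mule_ge0// ?lee_fin// pairing_ge0. Qed.

Lemma measurable_terminal_mass : measurable_fun [set: OmegaX] terminal_mass.
Proof. by apply: measurable_funeM; exact: measurable_pairingT. Qed.

Lemma admissible_ord n (t : 'I_n -> R) (f : 'I_n -> borel S -> R) (s : seq 'I_n) q :
  (forall i j : 'I_n, (i < j)%N -> (t i < t j)%R) ->
  (forall i, Bplus eta (f i)) ->
  sorted ltn (map val s) -> (forall i, i \in s -> (q <= t i <= T)%R) ->
  admissible T eta q [seq (t i, f i) | i <- s].
Proof.
move=> t_incr Bf; elim: s q => //= i s IH q sorted_is ts; split => //=.
- by case/andP: (ts i (mem_head _ _)).
- by case/andP: (ts i (mem_head _ _)).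
- apply: IH; first exact: path_sorted sorted_is.
  move=> j js; have /andP[_ ->] := ts j (mem_behead (s := i :: s) js).
  rewrite andbT; apply: ltW; apply: t_incr.
  have /allP := order_path_min ltn_trans sorted_is; apply.
  exact: map_f.
Qed.

Lemma J_atomic_ge0 A J w : J_atomic Z X A J -> 0 <= J w.
Proof.
move=> [_ [n [t [f [[_ _ mf fM _] ->]]]]]; apply: sume_ge0 => i _.
by apply: pairing_ge0 => y; have [M /(_ y)/andP[]] := fM i.
Qed.

Lemma measurable_J_atomic A J : J_atomic Z X A J -> measurable_fun [set: OmegaX] J.
Proof.
move=> [_ [n [t [f [[t_ge0 _ mf fM _] ->]]]]].
rewrite (_ : (fun w => _) = fun w => \sum_(i <- [seq i <- enum 'I_n | (t i <= T)%R])
    pairing (f i) (X (t i) w)).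
  apply: measurable_sum_seq => i; rewrite mem_filter => /andP[tT _].
  apply: measurable_pairingT => //; first by rewrite t_ge0.
  by move=> y; have [M /(_ y)/andP[]] := fM i.
apply/funext => w; rewrite big_filter big_enum_cond.
by apply: eq_bigl => i.
Qed.

(** The truncations f_i /\ N eta and k eta /\ N lie in B_eta^+, where
    [atom_laplace_ge] and [evolution_decay] apply with bounds that do not depend
    on N. The atoms before r contribute to neither side, as X vanishes there. *)
Lemma atomic_lower_bound (A : random_measure) (J : OmegaX -> \bar R) :
  J_atomic Z X A J ->
  expeR (- (mean_functional A + terminal_bound)) <=
  \int[law X r (eta_dirac eta z)]_w expeR (- (J w + terminal_mass w)).
Proof.
move=> AJ; have mJ := measurable_J_atomic AJ.
move: AJ mJ => [_ [n [t [f [[t_ge0 t_incr mf fM AE] ->]]]]] mJ.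
have f0 i y : (0 <= f i y)%R by have [M /(_ y)/andP[]] := fM i.
pose s := [seq i <- enum 'I_n | (r <= t i <= T)%R].
have sP i : i \in s -> (r <= t i <= T)%R by rewrite mem_filter => /andP[].
have s_sorted : sorted ltn (map val s).
  rewrite sorted_map; apply: sorted_filter; first by move=> ? ? ?; exact: ltn_trans.
  by rewrite -sorted_map val_enum_ord iota_ltn_sorted.
pose f_ N i y := Num.min (f i y) (N%:R * eta y)%R.
(* The factor 1 makes this an instance of [cvg_pairing_min]. *)
pose F_ N y := Num.min (k * eta y)%R (N%:R * 1)%R.
have Neta0 (N : nat) y : (0 <= N%:R * eta y)%R by rewrite mulr_ge0.
have f_ge0 N i y : (0 <= f_ N i y)%R by rewrite le_min f0 Neta0.
have mf_ N i : measurable_fun [set: borel S] (f_ N i).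
  by apply: measurable_minr => //; exact: measurable_funM.
have Bf N i : Bplus eta (f_ N i).
  split => //.
    have [M Mf] := fM i; exists M => y; rewrite ge_min.
    by case/andP: (Mf y) => _ ->.
  by exists N%:R => y; rewrite ge_min lexx orbT.
have mketa : measurable_fun [set: borel S] (fun y => k * eta y)%R by exact: measurable_funM.
have keta0 y : (0 <= k * eta y)%R by rewrite mulr_ge0.
have BF N : Bplus eta (F_ N).
  split.
  - by apply: measurable_minr => //; exact: measurable_funM.
  - by move=> y; rewrite le_min keta0 mulr1 ler0n.
  - by exists (N%:R * 1)%R => y; rewrite ge_min lexx orbT.
  - by exists k => y; rewrite ge_min lexx.
pose L N : atoms R S := [seq (t i, f_ N i) | i <- s].
have aL N : admissible T eta r (L N) by exact: admissible_ord.
pose G N w := atom_pairing X (L N) w + pairing (F_ N) (X T w).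
pose Jr w := \sum_(i <- s) pairing (f i) (X (t i) w).
set J' := fun w => \sum_(i < n | (t i <= T)%R) pairing (f i) (X (t i) w).
have JE w : J' w = \sum_(i <- enum 'I_n | (t i <= T)%R) pairing (f i) (X (t i) w).
  by rewrite big_enum_cond; apply: eq_bigl => i.
have LE N w : atom_pairing X (L N) w = \sum_(i <- s) pairing (f_ N i) (X (t i) w).
  by rewrite /atom_pairing big_map.
have cG w : G N w @[N --> \oo] --> Jr w + terminal_mass w.
  rewrite /G; under eq_fun do rewrite LE; apply: cvgeD.
  - rewrite ge0_adde_def// inE ?terminal_mass_ge0//.
    by apply: sume_ge0 => i _; exact: pairing_ge0.
  - apply: (@cvg_nnesum _ _ s xpredT (fun N i => pairing (f_ N i) (X (t i) w))).
      by move=> N i; exact: pairing_ge0.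
    by move=> i; exact: cvg_pairing_min.
  - have -> : terminal_mass w = pairing (fun y => k * eta y)%R (X T w).
      rewrite /terminal_mass /pairing -ge0_integralZl//.
      + exact/measurable_EFinP.
      + by move=> y _; rewrite lee_fin.
    exact: (@cvg_pairing_min _ _ _ _ (cst 1%R)).
have mG N : measurable_fun [set: OmegaX] (G N).
  have [mFN FN0 _ _] := BF N.
  apply: emeasurable_funD; last exact: measurable_pairingT.
  rewrite (_ : atom_pairing _ _ = fun w => \sum_(i <- s) pairing (f_ N i) (X (t i) w)).
    apply: measurable_sum_seq => i /sP/andP[_ tT].
    by apply: measurable_pairingT => //; rewrite t_ge0.
  by apply/funext => w; exact: LE.
have G0 N w : 0 <= G N w.
  have [mFN FN0 _ _] := BF N.
  by rewrite adde_ge0 ?pairing_ge0//; exact: atom_pairing_ge0 (aL N).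
have cI : \int[law X r (eta_dirac eta z)]_w expeR (- G N w) @[N --> \oo] -->
    \int[law X r (eta_dirac eta z)]_w expeR (- (J' w + terminal_mass w)).
  apply: laplace_cvg => //.
    by apply: emeasurable_funD => //; exact: measurable_terminal_mass.
  have : {ae law X r (eta_dirac eta z), forall w, forall i : 'I_n,
      (t i < r)%R -> X (t i) w setT = 0}.
    apply: ae_forall_ord => i; have [tr|rt] := ltP (t i) r.
      by apply: filterS (hX.2 r (t i) (eta_dirac eta z) (t_ge0 i) tr rT') => w + _.
    by apply: aeW.
  apply: filterS => w X0; split => //.
  suff -> : J' w = Jr w by exact: cG.
  rewrite JE /Jr big_filter big_mkcond [RHS]big_mkcond; apply: eq_bigr => i _.
  case: (boolP (t i <= T)%R) => tT; last by rewrite andbF.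
  rewrite andbT; case: ifPn => //; rewrite -ltNge => tr.
  by rewrite pairing_null// X0.
have bound N : expeR (- (mean_functional A + terminal_bound)) <=
    \int[law X r (eta_dirac eta z)]_w expeR (- G N w).
  have [w0 Lw] := log_laplace_exists hX (BF N) T0T.
  apply: le_trans (atom_laplace_ge hS hZ beta_gt0 eta_gt0 hX eta_i _ (BF N) Lw r0T (aL N)).
  have [mw w00 _ _] := log_laplace_Bplus Lw r0T.
  have [ma _ _ _] := Bplus_atom_mean eta_gt0 eta_i r0 (aL N).
  rewrite pairing_dirac; last exact: measurable_funD.
  have Fk y : (F_ N y <= k * eta y)%R by rewrite ge_min lexx.
  have w0_le : (w0 r z)%:E <= terminal_bound.
    exact: (@evolution_decay R S dO Omega beta eta Z hS hZ beta_gt0 eta_gt0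
      T cT T_gt0 cT_gt0 eta_i (F_ N) k w0 (BF N) Fk k_ge0 Lw.1 r z rT).
  rewrite lee_expeR leeN2 EFinD; apply: leeD w0_le.
  rewrite /atom_mean big_map -sumEFin /mean_functional.
  have -> : \int[law Z r z]_w A w `[r, T]%classic =
      \int[law Z r z]_w \sum_(i <- s) (f i (Z (t i) w))%:E.
    apply: eq_integral => w _; rewrite AE ?r0// -sumEFin big_filter big_enum_cond.
    by apply: eq_bigl => i.
  rewrite ge0_integral_sum//; last 2 first.
  - by move=> i; apply/measurable_EFinP; exact: measurable_observableT.
  - by move=> i w _; rewrite lee_fin.
  apply: lee_sum => i _ /=; rewrite -(transition_fineK _ _ _ (Bf N i))//.
  by apply: transition_le_fun => // y; rewrite ge_min lexx.
rewrite -(cvg_lim _ cI)//.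
apply: lime_ge; last exact: nearW.
by apply/cvg_ex; eexists; exact: cI.
Qed.

Lemma calA1T_closed_end (A : random_measure) : calA1T Z T A ->
  {ae law Z r z, forall w, A w `[r, T]%classic = A w `[r, +oo[%classic}.
Proof.
move=> [_ AT]; have [_] := AT r z r0T; apply: filterS => w A0.
rewrite (_ : `[r, +oo[%classic = `[r, T] `|` `]T, +oo[); last first.
  rewrite -itv_bndbnd_setU// bnd_simp//.
have disj : `[r, T]%classic `&` `]T, +oo[%classic = set0.
  by apply/seteqP; split => // s /= []; rewrite !in_itv/= andbT => /andP[_ sT]; rewrite ltNge sT.
have -> := measureU (A w) (measurable_itv `[r, T]) (measurable_itv `]T, +oo[) disj.
by rewrite [X in _ + X](A0 : A w `]T, +oo[%classic = 0) adde0.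
Qed.

(** The approximating functionals are uniformly bounded, and restricting them to
    [r, T] does not change them almost surely: dominated convergence. *)
Lemma mean_functional_cvg (An : nat -> random_measure) (A : random_measure) :
  (forall n, calA1T Z T (An n)) -> calA1T Z T A ->
  bounded_approx Z `[0%R, T] An A ->
  mean_functional (An n) @[n --> \oo] --> mean_functional A.
Proof.
move=> AnT AT [cA [T' [T'0 An0 [M AnM]]]].
have mitv (B : random_measure) : measurable_fun [set: Omega] (fun w => B w `[r, T]%classic).
  by apply: measurable_kernel; exact: measurable_itv.
have aeAn := ae_foralln (fun n => calA1T_closed_end (AnT n)).
have cAr := cA r z (r0T : `[0%R, T]%classic r).
have [] // := @dominated_convergence _ Omega R (law Z r z) setT measurableT
  (fun n w => An n w `[r, T]%classic) (fun w => A w `[r, T]%classic) (cst M%:E).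
- move: aeAn cAr (calA1T_closed_end AT); apply: filterS3 => w E1 c E2 _.
  by rewrite E2; under eq_fun do rewrite E1.
- exact: finite_measure_integrable_cst.
- apply: filterS aeAn => w E1 n _; rewrite gee0_abs// E1.
  apply: (le_trans _ (AnM n w)).
  apply: (@le_trans _ _ (An n w (`[0%R, T'] `|` `[T', +oo[)%classic)).
    apply: le_measure; rewrite ?inE; [exact: measurable_itv| |].
      by apply: measurableU; exact: measurable_itv.
    move=> s /=; rewrite !in_itv/= !andbT => rs.
    by have [sT'|sT'] := leP s T'; [left; rewrite (le_trans r0 rs)|right; exact: ltW].
  apply: (le_trans (measureU2 _ _ _)); [exact: measurable_itv|exact: measurable_itv|].
  by rewrite [X in _ + X](An0 n w) adde0.
Qed.

(** [J] is determined up to a null set only; the upper limit of the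
    approximating sequence is a measurable version of it. *)
Lemma bounded_lower_bound A J : J_bounded Z X r (eta_dirac eta z) A J ->
  exists J' : OmegaX -> \bar R,
    [/\ measurable_fun setT J', (forall w, 0 <= J' w),
        {ae law X r (eta_dirac eta z), forall w, J' w = J w} &
        expeR (- (mean_functional A + terminal_bound)) <=
        \int[law X r (eta_dirac eta z)]_w expeR (- (J' w + terminal_mass w))].
Proof.
move=> [_ AT [An [Jn [AJ bA cJ]]]].
have mJn n : measurable_fun setT (Jn n) by exact: measurable_J_atomic (AJ n).2.
have Jn0 n w : 0 <= Jn n w by exact: J_atomic_ge0 (AJ n).2.
pose J' w := limn_esup (Jn ^~ w).
have J'0 w : 0 <= J' w.
  rewrite /J' limn_esup_lim; apply: lime_ge; first exact: is_cvg_esups.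
  apply: nearW => n; apply: le_trans (ereal_sup_ubound _); first exact: (Jn0 n w).
  by exists n => //=.
have mJ' : measurable_fun setT J' by exact: measurable_fun_limn_esup.
exists J'; split => //.
  by apply: filterS cJ => w c; rewrite /J' (cvg_limn_einf_sup c).2.
have c1 : \int[law X r (eta_dirac eta z)]_w expeR (- (Jn n w + terminal_mass w))
    @[n --> \oo] --> \int[law X r (eta_dirac eta z)]_w expeR (- (J' w + terminal_mass w)).
  apply: (@laplace_cvg _ _ _ _ (fun n w => Jn n w + terminal_mass w)).
  - by move=> n; apply: emeasurable_funD => //; exact: measurable_terminal_mass.
  - by apply: emeasurable_funD => //; exact: measurable_terminal_mass.
  - apply: filterS cJ => w c; split => [n|]; first by rewrite adde_ge0 ?terminal_mass_ge0.
    apply: cvgeD; [|by rewrite /J' (cvg_limn_einf_sup c).2|exact: cvg_cst].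
    by rewrite ge0_adde_def// inE ?terminal_mass_ge0.
have AnT n : calA1T Z T (An n) by case: (AJ n).2.
have mean0 B : 0 <= mean_functional B by apply: integral_ge0.
have bound0 : 0 <= terminal_bound.
  rewrite mule_ge0 ?transition_ge0// lee_fin divr_ge0// powR_ge0//.
have c2 : expeR (- (mean_functional (An n) + terminal_bound))
    @[n --> \oo] --> expeR (- (mean_functional A + terminal_bound)).
  apply: cvg_expeRN; first by rewrite adde_ge0.
  apply: cvgeD; [by rewrite ge0_adde_def// inE|exact: mean_functional_cvg|exact: cvg_cst].
rewrite -(cvg_lim _ c1)// -(cvg_lim _ c2)//; apply: lee_lim.
- by apply/cvg_ex; eexists; exact: c2.
- by apply/cvg_ex; eexists; exact: c1.
- by apply: nearW => n; exact: atomic_lower_bound (AJ n).2.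
Qed.

Lemma J_functional_ge0 A J : J_functional Z X r (eta_dirac eta z) A J ->
  {ae law X r (eta_dirac eta z), forall w, 0 <= J w}.
Proof.
move=> [_ _ [An [Jn [AJ _ cJ]]]].
have aeJ n : {ae law X r (eta_dirac eta z), forall w, 0 <= Jn n w}.
  have [J' [_ J'0 E _]] := bounded_lower_bound (AJ n).
  by apply: filterS E => w <-.
move: cJ (ae_foralln aeJ); apply: filterS2 => w c J0; exact: ge0_cvg c.
Qed.

(** The approximating functionals are dominated by [A], and so are their means. *)
Lemma J_functional_lower_bound A J : J_functional Z X r (eta_dirac eta z) A J ->
  expeR (- (mean_functional A + terminal_bound)) <=
  \int[law X r (eta_dirac eta z)]_w expeR (- (J w + terminal_mass w)).
Proof.
move=> [mJ AT [An [Jn [AJ mA cJ]]]].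
pose P n (J' : OmegaX -> \bar R) :=
    [/\ measurable_fun setT J', (forall w, 0 <= J' w),
        {ae law X r (eta_dirac eta z), forall w, J' w = Jn n w} &
        expeR (- (mean_functional (An n) + terminal_bound)) <=
        \int[law X r (eta_dirac eta z)]_w expeR (- (J' w + terminal_mass w))].
have [J' J'P] := @choice _ _ P (fun n => bounded_lower_bound (AJ n)).
have aeJ : {ae law X r (eta_dirac eta z), forall w, forall n, J' n w = Jn n w}.
  by apply: ae_foralln => n; have [] := J'P n.
have c1 : \int[law X r (eta_dirac eta z)]_w expeR (- (J' n w + terminal_mass w))
    @[n --> \oo] --> \int[law X r (eta_dirac eta z)]_w expeR (- (J w + terminal_mass w)).
  apply: (@laplace_cvg _ _ _ _ (fun n w => J' n w + terminal_mass w)).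
  - by move=> n; have [? _ _ _] := J'P n; apply: emeasurable_funD => //; exact: measurable_terminal_mass.
  - by apply: emeasurable_funD => //; exact: measurable_terminal_mass.
  - move: cJ aeJ; apply: filterS2 => w c E.
    have J'0 n : 0 <= J' n w by have [] := J'P n.
    have c' : J' n w @[n --> \oo] --> J w by under eq_fun do rewrite E.
    split => [n|]; first by rewrite adde_ge0 ?terminal_mass_ge0.
    apply: cvgeD => //; last exact: cvg_cst.
    by rewrite ge0_adde_def// inE ?terminal_mass_ge0//; exact: ge0_cvg c'.
rewrite -(cvg_lim _ c1)//; apply: lime_ge.
  by apply/cvg_ex; eexists; exact: c1.
apply: nearW => n; have [_ _ _] := J'P n; apply: le_trans.
rewrite lee_expeR leeN2 leeD2r//; apply: ge0_le_integral => //.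
- by apply: measurable_kernel; exact: measurable_itv.
- by apply: measurable_kernel; exact: measurable_itv.
- move=> w _.
  have rTR : `[r, T]%classic `<=` Rplus R.
    by move=> s; rewrite /= !in_itv/= andbT => /andP[rs _]; exact: le_trans rs.
  have [nd c] := mA w _ (measurable_itv `[r, T]) rTR.
  rewrite -(cvg_lim _ c)//; apply: lime_ge; first by apply/cvg_ex; eexists; exact: c.
  by exists n => // m /= nm; exact: nd.
Qed.

End J_lower_bound.

(** * Extinction at the final time *)

Section extinction.
Context {R : realType}.

Lemma neg_lne_le (I c : \bar R) : expeR (- c) <= I -> - lne I <= c.
Proof.
move=> cI; rewrite leeNl -[leLHS]expeRK lee_lne// in_itv/= leey andbT.
  exact: expeR_ge0.
exact: le_trans (expeR_ge0 _) cI.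
Qed.

Lemma pairing_eta_fin (S : ptopologicalType) (eta : {mfun borel S >-> R})
    (nu : eta_measures eta) : (forall y, 0 <= eta y)%R -> pairing eta nu \is a fin_num.
Proof.
by move=> eta0; rewrite ge0_fin_numE ?pairing_ge0//; exact: eta_measure_fin.
Qed.

Lemma pairing_eta_gt0 (S : ptopologicalType) (eta : {mfun borel S >-> R})
    (nu : eta_measures eta) : (forall y, 0 < eta y)%R -> nu setT != 0 ->
  0 < pairing eta nu.
Proof.
move=> eta_gt0 nuT; have eta0 y : (0 <= eta y)%R by exact: ltW.
rewrite lt0e pairing_ge0// andbT; apply: contra_neq nuT => nu0.
have meta : measurable_fun [set: borel S] (fun y => (eta y)%:E) by exact/measurable_EFinP.
have : ae_eq nu setT (fun y => (eta y)%:E) (cst 0).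
  apply/(ae_eq_integral_abs nu measurableT meta).
  rewrite -[RHS]nu0; apply: eq_integral => y _.
  by rewrite gee0_abs// lee_fin.
move=> [N [mN N0 subN]]; apply/eqP; rewrite eq_le measure_ge0 andbT -N0.
apply: le_measure; rewrite ?inE//.
move=> y _; apply: subN => /= /(_ I) [] /eqP.
by rewrite gt_eqF.
Qed.

End extinction.

Theorem proposition3p7 (R : realType) (S : ptopologicalType)
  (hS : metrizable_luzin R S)
  (dO : measure_display) (Omega : measurableType dO)
  (Z : markov_process (Rplus R) (borel S) Omega) (hZ : right_process Z)
  (T beta : R) (hT : (0 < T)%R) (hbeta : (0 < beta <= 1)%R)
  (eta : {mfun borel S >-> R}) (eta_gt0 : forall y, (0 < eta y)%R)
  (cT : R) (hcT : (0 < cT)%R)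
  (h : R -> borel S -> \bar R)
  (h_def : forall r y, h r y = \int[law Z r y]_w (eta (Z T w))%:E)
  (eta_i : forall (r t : R) (y : borel S), (0 <= r)%R -> (r <= t)%R -> (t <= T)%R ->
    (cT^-1 * eta y)%R%:E <= \int[law Z r y]_w (eta (Z t w))%:E <= (cT * eta y)%R%:E)
  (eta_ii : forall eps : R, (0 < eps)%R -> \forall t \near T^'-,
    forall y : borel S, `|\int[law Z t y]_w (eta (Z T w))%:E - (eta y)%:E| < eps%:E)
  (dX : measure_display) (OmegaX : measurableType dX)
  (X : markov_process `[0%R, T] (eta_measures eta) OmegaX)
  (hX : is_superprocess beta Z X)
  (A : R.-ker Omega ~> measurableTypeR R) (hA : calA1T Z T A)
  (k r : R) (z : borel S) (hk : (0 <= k)%R) (hr : (0 <= r < T)%R)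
  (JA : OmegaX -> \bar R) (hJA : J_functional Z X r (eta_dirac eta z) A JA) :
  (- lne (\int[law X r (eta_dirac eta z)]_w
            expeR (- JA w - k%:E * pairing eta (X T w)))
    <= \int[law Z r z]_w A w `[r, T]%classic +
       h r z * (k / (1 + cT `^ (- beta) * (T - r) * k `^ beta) `^ beta^-1)%R%:E)
  /\
  (- lne (\int[law X r (eta_dirac eta z)]_(w in [set w | X T w setT = 0])
            expeR (- JA w))
    <= \int[law Z r z]_w A w `[r, T]%classic +
       cT%:E * h r z * ((T - r) `^ beta^-1)^-1%R%:E).
Proof.
have /andP[beta_gt0 _] := hbeta.
have /andP[r0 rT] := hr; have rT' := ltW rT.
have eta_ge0 y : (0 <= eta y)%R by exact: ltW.
have meta : measurable_fun [set: borel S] eta by [].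
have T0T : (0 <= T <= T)%R by rewrite lexx ltW.
have bound c : (0 <= c)%R -> _ := fun c0 =>
  J_functional_lower_bound hS hZ hT beta_gt0 eta_gt0 hX hcT eta_i c0 hr hJA.
have pfin w : pairing eta (X T w) \is a fin_num by exact: pairing_eta_fin.
split.
  apply: neg_lne_le.
  have := bound k hk; rewrite /terminal_bound -[transition Z r T eta z]h_def.
  rewrite /mean_functional => /le_trans; apply.
  rewrite le_eqVlt; apply/orP; left; apply/eqP; apply: eq_integral => w _.
  by rewrite /terminal_mass oppeD// fin_num_adde_defl// fin_numM.
apply: neg_lne_le.
have [mJ _ _] := hJA.
have JA0 := J_functional_ge0 hS hZ hT beta_gt0 eta_gt0 hX hcT eta_i (lexx 0%R) hr hJA.
pose E := [set w | X T w setT = 0].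
have mXT : measurable_fun [set: OmegaX] (X T).
  apply: measurable_stateT; first exact: interval_is_interval.
  by rewrite /= in_itv.
have mE : measurable E.
  rewrite -[X in measurable X]setTI.
  apply: (measurableT_comp (measurable_evaluation measurableT) mXT measurableT
    (Y := [set 0])).
  exact: emeasurable_set1.
pose G_ (n : nat) w := JA w + terminal_mass X n%:R w.
(* exp (- G) is exp (- JA) on E and vanishes elsewhere. *)
pose G w := if w \in E then JA w else +oo.
have mG_ n : measurable_fun [set: OmegaX] (G_ n).
  apply: emeasurable_funD => //; exact: measurable_terminal_mass.
have mG : measurable_fun [set: OmegaX] G.
  apply: measurable_fun_ifT => //.
  by apply: (measurable_fun_bool true); rewrite setTI preimage_mem_true.
have cG : \int[law X r (eta_dirac eta z)]_w expeR (- G_ n w) @[n --> \oo] -->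
    \int[law X r (eta_dirac eta z)]_w expeR (- G w).
  apply: laplace_cvg => //; apply: filterS JA0 => w J0; split => [n|].
    by rewrite adde_ge0// terminal_mass_ge0.
  rewrite /G_ /G /terminal_mass; case: ifPn => [/set_mem wE|/negP wE].
    by under eq_fun do rewrite pairing_null// mule0 adde0; exact: cvg_cst.
  have p0 : 0 < pairing eta (X T w).
    by apply: pairing_eta_gt0 => //; apply/eqP => X0; apply: wE; rewrite inE.
  apply/cvgeyPge => M; near=> n.
  apply: (@le_trans _ _ (n%:R%:E * pairing eta (X T w))); last by rewrite leeDr.
  rewrite -(fineK (pfin w)) -EFinM lee_fin -ler_pdivrMr; last by rewrite fine_gt0// p0 ltey_eq pfin.
  by near: n; exact: nbhs_infty_ger.
have -> : \int[law X r (eta_dirac eta z)]_(w in E) expeR (- JA w) =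
    \int[law X r (eta_dirac eta z)]_w expeR (- G w).
  rewrite [LHS]integral_mkcond; apply: eq_integral => w _.
  by rewrite patchE /G; case: ifPn.
rewrite -(cvg_lim _ cG)//; apply: lime_ge; first by apply/cvg_ex; eexists; exact: cG.
apply: nearW => n; apply: le_trans (bound n%:R (ler0n _ _)).
rewrite lee_expeR leeN2 /mean_functional leeD2l// /terminal_bound h_def.
rewrite -/(transition Z r T eta z) (muleC cT%:E) -muleA lee_wpmul2l ?transition_ge0//.
by rewrite -EFinM lee_fin powR_saturation// subr_gt0.
Unshelve. all: by end_near. Qed.
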